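(* Let $A$ be a finite abelian group, $\chi$ a non-degenerate symmetric bicharacter of $A$, and $\tau$ a square root of $|A|^{-1}$. Let $m$ be the non-invertible simple object of $\mathcal{TY}(A,\chi,\tau)$, equipped with its canonical pivotal structure, and let $k\ge1$ be an integer. Then $\nu_{2k}(m)=\sqrt{|A[k]|}\cdot\xi$ for some $\xi\in\mu_8\cup\{0\}$. Moreover: (a) Fix $\rho\in C(\chi)$. Then $\xi=0$ if and only if there exists $a\in A[k]$ such that $\rho(a)^k\ne1$. (b) Suppose that $|A|$ is odd. Then $\xi^2=+1$ if $|A|^{k-1}/|A[k]|\equiv1\pmod 4$, and $\xi^2=-1$ otherwise.
   Context: Everything is over $\mathbb{C}$; groups are written multiplicatively. $\mu_8$ is the set of 8th roots of unity in $\mathbb{C}$, and $A[k]=\{a\in A\mid a^k=1\}$. A bicharacter of $A$ is a map $\chi: A\times A\to\mathbb{C}^\times$ multiplicative in each variable; it is symmetric if $\chi(a,b)=\chi(b,a)$, and non-degenerate if $\chi(x,a)=1$ for all $x\in A$ implies $a=1$. $C(\chi)$ is the (non-empty) set of functions $\rho:A\to\mathbb{C}^\times$ with $\rho(a)\rho(ab)^{-1}\rho(b)=\chi(a,b)$ for all $a,b\in A$. Tambara-Yamagami category. $\mathcal{TY}(A,\chi,\tau)$ (with $\tau\in\mathbb{R}$, $\tau^2=|A|^{-1}$) is the skeletal $\mathbb{C}$-linear monoidal category whose objects are finite direct sums of elements of $S=A\sqcup\{m\}$, with $\mathrm{Hom}(s,s')=\mathbb{C}$ if $s=s'$ and $0$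 otherwise ($s,s'\in S$) and the obvious composition. The tensor product is $a\otimes b=ab$, $a\otimes m=m=m\otimes a$, $m\otimes m=\bigoplus_{x\in A}x$ ($a,b\in A$). The unit object is $1\in A$ with identity unit constraints. The associativity constraint $\Phi_{X,Y,Z}:(X\otimes Y)\otimes Z\to X\otimes(Y\otimes Z)$ is determined by $\Phi_{a,m,b}=\chi(a,b)\,\mathrm{id}_m$, $\Phi_{m,a,m}=(\chi(a,x)\delta_{x,y}\mathrm{id}_x)_{x,y}:\bigoplus_x x\to\bigoplus_y y$, $\Phi_{m,m,m}=(\tau\chi(x,y)^{-1}\mathrm{id}_m)_{x,y}:\bigoplus_{x\in A}m\to\bigoplus_{y\in A}m$, all other $\Phi_{s,t,u}$ ($s,t,u\in S$) being identities. The left dual of $a\in A$ is $a^{-1}$ with identity coevaluation and evaluation; the left dual of $m$ is $m$ with coevaluation the injection $1\to m\otimes m$ and evaluation $\tau^{-1}p$, where $p:m\otimes m\to1$ is the projection. The bidual functor is the identity, and the canonical pivotal structure is $j_a=\mathrm{id}_a$ ($a\in A$), $j_m=\mathrm{sgn}(\tau)\,\mathrm{id}_m$. Frobenius-Schur indicators. Let $\mathcal{C}$ be a $\mathbb{C}$-linear rigid monoidal category with pivotal structure $j:\mathrm{id}\to(-)^{**}$, coevaluations $d_V:1\to V\otimes V^*$ and evaluations $b_V:V^*\otimes V\to 1$. Put $V^{\otimes0}=1$, $V^{\otimes 1}=V$, $V^{\otimes n}=V\otimes V^{\otimes(n-1)}$ for $n\ge2$. Let $A^X_{Y,Z}:\mathrm{Hom}(X,Y\otimes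 Z)\to\mathrm{Hom}(Y^*\otimes X,Z)$ and $B^{X,Y}_Z:\mathrm{Hom}(X\otimes Y,Z)\to\mathrm{Hom}(X,Z\otimes Y^* )$ be the standard duality isomorphisms (up to associativity, $f\mapsto(b_Y\otimes\mathrm{id}_Z)(\mathrm{id}_{Y^*}\otimes f)$ and $g\mapsto(g\otimes\mathrm{id}_{Y^*})(\mathrm{id}_X\otimes d_Y)$). Define the linear automorphism $E_V^{(n)}$ of $\mathrm{Hom}(1,V^{\otimes n})$ by $E_V^{(n)}(f)=\Phi\circ(\mathrm{id}_{V^{\otimes(n-1)}}\otimes j_V^{-1})\circ B^{1,V^*}_{V^{\otimes(n-1)}}(A^1_{V,V^{\otimes(n-1)}}(f))$, where $\Phi:V^{\otimes(n-1)}\otimes V\to V^{\otimes n}$ is the associativity isomorphism. The $n$-th Frobenius-Schur indicator is $\nu_n(V)=\mathrm{Tr}(E_V^{(n)})$. *)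

(* Defs.v *)
From HB Require Import structures.
From mathcomp Require Import all_boot all_order all_algebra all_fingroup all_solvable.
From mathcomp Require Import all_reals.
From mathcomp Require Export complex.

Set Implicit Arguments.
Unset Strict Implicit.
Unset Printing Implicit Defensive.

Import GRing.Theory Num.Theory.

Local Open Scope ring_scope.

(* Structure maps of a K-linear rigid monoidal category with a pivotal        *)
(* structure.  Only the structure maps and the bilinearity that makes the     *)
(* Frobenius-Schur operator linear are recorded: the indicators depend on     *)
(* nothing else.  Composition is in the usual order: mcomp g f is g after f.  *)
Record pivotalData (K : fieldType) : Type := PivotalData {
  ob :> Type;
  mor : ob -> ob -> vectType K;
  mor1 : forall X, mor X X;
  mcomp : forall X Y Z, mor Y Z -> mor X Y -> mor X Z;
  tunit : ob;
  tens : ob -> ob -> ob;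
  tensm : forall X X' Y Y',
    mor X X' -> mor Y Y' -> mor (tens X Y) (tens X' Y');
  assoc : forall X Y Z, mor (tens (tens X Y) Z) (tens X (tens Y Z));
  assocV : forall X Y Z, mor (tens X (tens Y Z)) (tens (tens X Y) Z);
  lunit : forall X, mor (tens tunit X) X;
  lunitV : forall X, mor X (tens tunit X);
  runit : forall X, mor (tens X tunit) X;
  runitV : forall X, mor X (tens X tunit);
  dual : ob -> ob;
  ev : forall X, mor (tens (dual X) X) tunit;
  coev : forall X, mor tunit (tens X (dual X));
  piv : forall X, mor X (dual (dual X));
  pivV : forall X, mor (dual (dual X)) X;
  comp_linearl : forall X Y Z (f : mor X Y),
    linear (fun g : mor Y Z => mcomp g f);
  comp_linearr : forall X Y Z (g : mor Y Z),
    linear (fun f : mor X Y => mcomp g f);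
  tensm_linearl : forall X X' Y Y' (g : mor Y Y'),
    linear (fun f : mor X X' => tensm f g);
  tensm_linearr : forall X X' Y Y' (f : mor X X'),
    linear (fun g : mor Y Y' => tensm f g)
}.

Arguments mor1 {K p} X.
Arguments mcomp {K p X Y Z} g f.
Arguments tunit {K p}.
Arguments tens {K p} X Y.
Arguments tensm {K p X X' Y Y'} f g.
Arguments assoc {K p} X Y Z.
Arguments assocV {K p} X Y Z.
Arguments lunit {K p} X.
Arguments lunitV {K p} X.
Arguments runit {K p} X.
Arguments runitV {K p} X.
Arguments dual {K p} X.
Arguments ev {K p} X.
Arguments coev {K p} X.
Arguments piv {K p} X.
Arguments pivV {K p} X.

Definition lfun_trace (K : fieldType) (V : vectType K) (f : 'End(V)) : K :=
  \tr (passmx.mxof (vbasis fullv) (vbasis fullv) f).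

Section Indicators.

Variables (K : fieldType) (C : pivotalData K).
Implicit Types X Y Z V : C.

Local Notation "g \oo f" := (mcomp g f) (at level 50, left associativity).
Local Notation "X \ox Y" := (tens X Y) (at level 40, left associativity).
Local Notation "f \om g" := (tensm f g) (at level 40, left associativity).

Fixpoint tpow V (n : nat) : C :=
  match n with
  | 0 => tunit
  | n'.+1 => match n' with 0 => V | _.+1 => V \ox tpow V n' end
  end.

Fixpoint tpow_assoc V (n : nat) : mor (tpow V n \ox V) (tpow V n.+1) :=
  match n with
  | 0 => lunit V
  | n'.+1 =>
    match n' return mor (tpow V n' \ox V) (tpow V n'.+1) ->
                    mor (tpow V n'.+1 \ox V) (tpow V n'.+2) with
    | 0 => fun=> mor1 (V \ox V)
    | n''.+1 => fun phi => (mor1 V \om phi) \oo assoc V (tpow V n''.+1) V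
    end (tpow_assoc V n')
  end.

(* For n = 0 this is the identification of V with V (x) 1. *)
Definition tpow_split V (n : nat) : mor (tpow V n.+1) (V \ox tpow V n) :=
  match n with
  | 0 => runitV V
  | n'.+1 => mor1 (V \ox tpow V n'.+1)
  end.

Definition dualA X Y Z (f : mor X (Y \ox Z)) : mor (dual Y \ox X) Z :=
  lunit Z \oo (ev Y \om mor1 Z) \oo assocV (dual Y) Y Z
    \oo (mor1 (dual Y) \om f).

Definition dualB X Y Z (g : mor (X \ox Y) Z) : mor X (Z \ox dual Y) :=
  (g \om mor1 (dual Y)) \oo assocV X Y (dual Y) \oo (mor1 X \om coev Y)
    \oo runitV X.

(* FSop V n is the operator E_V^(n+1); the unit constraints in the middle     *)
(* identify Hom(V^* (x) 1, W) with Hom(1 (x) V^*, W).                         *)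
Definition FSop V (n : nat) (f : mor tunit (tpow V n.+1)) :
    mor tunit (tpow V n.+1) :=
  let W := tpow V n in
  let g : mor (dual V \ox tunit) W := dualA (tpow_split V n \oo f) in
  let g' : mor (tunit \ox dual V) W :=
    g \oo (runitV (dual V) \oo lunit (dual V)) in
  tpow_assoc V n \oo ((mor1 W \om pivV V) \oo dualB g').

Lemma FSop_is_linear V n : linear (@FSop V n).
Proof.
move=> a f g; rewrite /FSop /dualB /dualA.
by rewrite !(comp_linearr, tensm_linearr, comp_linearl, tensm_linearl).
Qed.

HB.instance Definition _ V n :=
  GRing.isLinear.Build K (mor tunit (tpow V n.+1)) (mor tunit (tpow V n.+1)) _
    (@FSop V n) (@FSop_is_linear V n).

(* nu_n(V), meaningful for n >= 1. *)
Definition FSind (n : nat) V : K := lfun_trace (linfun (@FSop V n.-1)).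

End Indicators.

Section TambaraYamagami.

Local Open Scope complex_scope.

Variables (R : realType) (A : finGroupType).
Variables (chi : A -> A -> R[i]) (tau : R).

(* The simple objects: Some a is the element a of A, and None is m. *)
Local Notation S := (option A).

(* Tensor products of simple objects are multiplicity free: fusion s t is the *)
(* set of simple summands of s (x) t.                                         *)
Definition fusion (s t : S) : pred S :=
  match s, t with
  | Some a, Some b => pred1 (Some (a * b)%g)
  | None, None => predC1 None
  | _, _ => pred1 None
  end.

(* Finite direct sums of simple objects, as finite families.  The identities  *)
(* a (x) b = ab, 1 (x) X = X, etc. of a skeletal model become the evident     *)
(* bijections between index sets preserving labels.                           *)
Record TYob : Type := TYOb { idx :> finType; lab : idx -> S }.
Arguments lab : clear implicits.

Definition TYhom (X Y : TYob) : vectType R[i] :=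
  {ffun {p : X * Y | lab X p.1 == lab Y p.2} -> R[i]^o}.

Definition entry (X Y : TYob) (f : TYhom X Y) (i : X) (j : Y) : R[i] :=
  oapp f 0 (insub (i, j)).

(* mkhom c discards the entries of c between distinct simple objects, so that *)
(* equality of labels is left implicit in the structure maps below.           *)
Definition mkhom (X Y : TYob) (c : X -> Y -> R[i]) : TYhom X Y :=
  [ffun p => c (val p).1 (val p).2].

Definition TYid (X : TYob) : TYhom X X := mkhom (fun i j => (i == j)%:R).

Definition TYcomp (X Y Z : TYob) (g : TYhom Y Z) (f : TYhom X Y) : TYhom X Z :=
  mkhom (fun i k => \sum_j entry g j k * entry f i j).

Definition TYsimple (s : S) : TYob := TYOb (fun _ : unit => s).

Definition TYone : TYob := TYsimple (Some 1%g).

(* The summands of X (x) Y are the triples (i, j, u) with u a simple summand  *)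
(* of the tensor product of the i-th summand of X and the j-th one of Y.      *)
Definition TYtens (X Y : TYob) : TYob :=
  @TYOb {p : X * Y * S | p.2 \in fusion (lab X p.1.1) (lab Y p.1.2)}
    (fun p => (val p).2).

Definition tfst (X Y : TYob) (p : TYtens X Y) : X := (val p).1.1.
Definition tsnd (X Y : TYob) (p : TYtens X Y) : Y := (val p).1.2.

Definition TYtensm (X X' Y Y' : TYob) (f : TYhom X X') (g : TYhom Y Y') :
    TYhom (TYtens X Y) (TYtens X' Y') :=
  mkhom (fun p q => entry f (tfst p) (tfst q) * entry g (tsnd p) (tsnd q)).

(* TYassoc6 s t r v u w is the component of the associativity constraint of   *)
(* the simple objects s, t, r from the summand v of u (x) r, for u a summand  *)
(* of s (x) t, to the summand v of s (x) w, for w a summand of t (x) r.       *)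
Definition TYassoc6 (s t r v u w : S) : R[i] :=
  match s, t, r with
  | Some a, None, Some b => chi a b
  | None, Some a, None => if v is Some x then chi a x else 0
  | None, None, None =>
      match u, w with
      | Some x, Some y => tau%:C * (chi x y)^-1
      | _, _ => 0
      end
  | _, _, _ => 1
  end.

(* The components of the inverse associativity constraint; the matrix         *)
(* (tau / chi x y) has inverse (tau * chi x y) by orthogonality of characters *)
(* and tau ^+ 2 = #|A|^-1.                                                    *)
Definition TYassocV6 (s t r v u w : S) : R[i] :=
  match s, t, r with
  | Some a, None, Some b => (chi a b)^-1
  | None, Some a, None => if v is Some x then (chi a x)^-1 else 0
  | None, None, None =>
      match u, w with
      | Some x, Some y => tau%:C * chi x y
      | _, _ => 0
      end
  | _, _, _ => 1
  end.

Definition TYassoc (X Y Z : TYob) :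
    TYhom (TYtens (TYtens X Y) Z) (TYtens X (TYtens Y Z)) :=
  mkhom (fun (p : TYtens (TYtens X Y) Z) (q : TYtens X (TYtens Y Z)) =>
    let ij := tfst p in let jk := tsnd q in
    if [&& tfst ij == tfst q, tsnd ij == tfst jk & tsnd p == tsnd jk]
    then TYassoc6 (lab X (tfst q)) (lab Y (tfst jk)) (lab Z (tsnd jk))
           (lab _ p) (lab _ ij) (lab _ jk)
    else 0).

Definition TYassocV (X Y Z : TYob) :
    TYhom (TYtens X (TYtens Y Z)) (TYtens (TYtens X Y) Z) :=
  mkhom (fun (q : TYtens X (TYtens Y Z)) (p : TYtens (TYtens X Y) Z) =>
    let ij := tfst p in let jk := tsnd q in
    if [&& tfst ij == tfst q, tsnd ij == tfst jk & tsnd p == tsnd jk]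
    then TYassocV6 (lab X (tfst q)) (lab Y (tfst jk)) (lab Z (tsnd jk))
           (lab _ p) (lab _ ij) (lab _ jk)
    else 0).

Definition TYlunit (X : TYob) : TYhom (TYtens TYone X) X :=
  mkhom (fun (p : TYtens TYone X) i => (tsnd p == i)%:R).
Definition TYlunitV (X : TYob) : TYhom X (TYtens TYone X) :=
  mkhom (fun i (p : TYtens TYone X) => (tsnd p == i)%:R).
Definition TYrunit (X : TYob) : TYhom (TYtens X TYone) X :=
  mkhom (fun (p : TYtens X TYone) i => (tfst p == i)%:R).
Definition TYrunitV (X : TYob) : TYhom X (TYtens X TYone) :=
  mkhom (fun i (p : TYtens X TYone) => (tfst p == i)%:R).

Definition sdual (s : S) : S := omap (fun a => a^-1)%g s.

Definition TYdual (X : TYob) : TYob := TYOb (fun i : X => sdual (lab X i)).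

Definition TYev (X : TYob) : TYhom (TYtens (TYdual X) X) TYone :=
  mkhom (fun (p : TYtens (TYdual X) X) _ =>
    if tfst p == tsnd p :> X
    then (if lab X (tsnd p) is Some _ then 1 else tau^-1%:C)
    else 0).

Definition TYcoev (X : TYob) : TYhom TYone (TYtens X (TYdual X)) :=
  mkhom (fun _ (p : TYtens X (TYdual X)) => (tfst p == tsnd p :> X)%:R).

(* The coefficient of the pivotal structure at s, equal to its inverse. *)
Definition spiv (s : S) : R[i] := if s is Some _ then 1 else (Num.sg tau)%:C.

Definition TYpiv (X : TYob) : TYhom X (TYdual (TYdual X)) :=
  @mkhom X (TYdual (TYdual X)) (fun i j : X =>
    if i == j then spiv (lab X i) else 0).
Definition TYpivV (X : TYob) : TYhom (TYdual (TYdual X)) X :=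
  @mkhom (TYdual (TYdual X)) X (fun i j : X =>
    if i == j then spiv (lab X j) else 0).

Lemma entry_linear (X Y : TYob) i j :
  linear (fun f : TYhom X Y => entry f i j : R[i]^o).
Proof.
move=> a f g; rewrite /entry; case: insub => [p|] /=; first by rewrite !ffunE.
by rewrite scaler0 addr0.
Qed.

Lemma TYcomp_linearl (X Y Z : TYob) (f : TYhom X Y) :
  linear (fun g : TYhom Y Z => TYcomp g f).
Proof.
move=> a g h; apply/ffunP => p; rewrite !ffunE scaler_sumr -big_split /=.
by apply: eq_bigr => j _; rewrite entry_linear mulrDl scalerAl.
Qed.

Lemma TYcomp_linearr (X Y Z : TYob) (g : TYhom Y Z) :
  linear (fun f : TYhom X Y => TYcomp g f).
Proof.
move=> a f h; apply/ffunP => p; rewrite !ffunE scaler_sumr -big_split /=.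
by apply: eq_bigr => j _; rewrite entry_linear mulrDr scalerAr.
Qed.

Lemma TYtensm_linearl (X X' Y Y' : TYob) (g : TYhom Y Y') :
  linear (fun f : TYhom X X' => TYtensm f g).
Proof.
by move=> a f h; apply/ffunP => p; rewrite !ffunE entry_linear mulrDl scalerAl.
Qed.

Lemma TYtensm_linearr (X X' Y Y' : TYob) (f : TYhom X X') :
  linear (fun g : TYhom Y Y' => TYtensm f g).
Proof.
by move=> a g h; apply/ffunP => p; rewrite !ffunE entry_linear mulrDr scalerAr.
Qed.

Definition TY : pivotalData R[i] :=
  PivotalData TYid TYassoc TYassocV TYlunit TYlunitV TYrunit TYrunitV
    TYev TYcoev TYpiv TYpivV
    TYcomp_linearl TYcomp_linearr TYtensm_linearl TYtensm_linearr.

Definition TYm : TY := TYsimple None.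

End TambaraYamagami.

Section Bicharacters.

Variables (A : finGroupType) (F : fieldType).
Implicit Types chi : A -> A -> F.

Definition bicharacter chi : Prop :=
  [/\ forall a b, chi a b != 0,
      forall a b c, chi (a * b)%g c = chi a c * chi b c
    & forall a b c, chi a (b * c)%g = chi a b * chi a c].

Definition symmetric_bichar chi : Prop := forall a b, chi a b = chi b a.

Definition nondegenerate_bichar chi : Prop :=
  forall a, (forall x, chi x a = 1) -> a = 1%g.

(* The set C(chi). *)
Definition quad_funs chi (rho : A -> F) : Prop :=
  (forall a, rho a != 0) /\
  (forall a b, rho a * (rho (a * b)%g)^-1 * rho b = chi a b).

End Bicharacters.

(* Main.v *)
From HB Require Import structures.
Require Import Defs.
From mathcomp Require Import all_boot all_order all_algebra all_fingroup all_solvable.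
From mathcomp Require Import all_reals.
From mathcomp Require Import ring zify.

(** The proof rests on an explicit formula for the indicator: with n = k - 1,

      nu_2k(m) = sgn(tau) * tau ^ n * T,
      T = sum over x in A^n of prod_i chi(x_i, x_(i-1)) / chi(x_i, x_i),

    where x_0 = 1.  It is read off from the matrix of E_m^(2k) in the basis of
    the paths of summands leading to 1 in m (x) (m (x) ...).  The duality maps
    only contribute sgn(tau), so the trace is a sum of diagonal entries of the
    associativity isomorphism (entry_rotation, FSind_indicator_sum).

    Written additively, T is the Gauss sum of B(x, x) for the biadditive form
    B(x, z) = prod_i chi(x_i, z_(i-1) - z_i) on V = A^n, called chain below.
    No function rho is needed to study it:

    - T * T^* can be computed.  The form B(x, z) B(z, x) is prod_i chi(u_i, z_i)
      with u the discrete Laplacian of x, the boundary values being 0; it is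
      trivial in z exactly when x = (a, 2a, ..., na) with k a = 0, and then
      B(x, x) = chi(a, a) ^ - C(k, 2).  The latter is a character of A[k], so
      T * T^* is |A|^n |A[k]| or 0 (gauss_sum_chain_norm, sum_torsion_char).
      If rho is in C(chi) then rho(a)^k = chi(a, a) ^ C(k, 2) on A[k], which
      gives the criterion for the vanishing of xi (quad_funs_expn).

    - T ^ 4 is real.  Choose a, b, c, d with a^2 + b^2 + c^2 + d^2 = -1 modulo
      |V|.  Left multiplication by the quaternion a + bi + cj + dk permutes V^4
      and inverts the product of the values B(x, x) at the four coordinates.
      Hence T ^ 4 equals its conjugate (gauss_sum_exp4), and T ^ 8 is the fourth
      power of T * T^*; so xi ^ 8 = 1 unless xi = 0.

    - If |A| is odd, pairing x with -x shows that T = 1 + 2 s with s an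
      algebraic integer, so that T ^ 2 = 1 modulo 4.  The character above is
      then trivial, so T ^ 8 = D ^ 4 with D = |A|^n |A[k]|.  As T ^ 4 is real,
      it is D ^ 2 or - D ^ 2, and the congruence excludes the latter; it also
      decides between T ^ 2 = D and T ^ 2 = - D according to D modulo 4
      (gauss_sum_odd_sqr). *)

Set Implicit Arguments.
Unset Strict Implicit.
Unset Printing Implicit Defensive.

Import GRing.Theory Num.Theory.

Local Open Scope ring_scope.

(** * Traces of endomorphisms of a space of functions *)

Lemma lfun_trace_ffun (K : fieldType) (I : finType)
    (f : 'End({ffun I -> K^o})) :
  lfun_trace f = \sum_i f [ffun j => (j == i)%:R] i.
Proof.
pose V := ({ffun I -> K^o} : vectType K).
pose e (i : I) : V := [ffun j => (j == i)%:R].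
have dec (v : V) : v = \sum_i v i *: e i.
  apply/ffunP => j; rewrite sum_ffunE (bigD1 j) //= big1 => [|i ij].
    by rewrite !ffunE eqxx addr0 [_ *: _]mulr1.
  by rewrite !ffunE eq_sym (negbTE ij) scaler0.
pose b := vbasis (fullv : {vspace V}).
have bP (v : V) : v = \sum_j coord b j v *: b`_j.
  by rewrite -coord_vbasis // memvf.
have -> : lfun_trace f = \sum_j coord b j (f b`_j).
  by apply: eq_bigr => j _; rewrite !mxE /= passmx.vecof_delta.
transitivity (\sum_j \sum_i coord b j (f (e i)) * (b`_j) i).
  apply: eq_bigr => j _; rewrite [in LHS](dec b`_j) !linear_sum.
  by apply: eq_bigr => i _; rewrite !linearZ /= mulrC.
rewrite exchange_big; apply: eq_bigr => i _.
rewrite [in RHS](bP (f (e i))) sum_ffunE.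
by apply: eq_bigr => j _; rewrite !ffunE.
Qed.

Lemma lfun_trace_linfun (K : fieldType) (I : finType)
    (f : {ffun I -> K^o} -> {ffun I -> K^o}) : linear f ->
  lfun_trace (linfun f) = \sum_i f [ffun j => (j == i)%:R] i.
Proof.
move=> f_lin.
pose V := ({ffun I -> K^o} : vectType K).
pose fL : {linear V -> V} :=
  HB.pack (f : V -> V) (GRing.isLinear.Build K V V _ f f_lin).
rewrite lfun_trace_ffun; apply: eq_bigr => i _.
by rewrite -[f]/(fL : V -> V) lfunE.
Qed.

(** * Entries of morphisms between sums of simple objects *)

Section Entries.

Variables (R : realType) (A : finGroupType).
Implicit Types X Y Z : TYob A.

Lemma entry_mkhom X Y (c : X -> Y -> R[i]) i j :
  entry (mkhom c) i j = if lab i == lab j then c i j else 0.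
Proof.
rewrite /entry; case: insubP => [p /= -> vp|/= /negbTE-> //].
by rewrite /= ffunE [val p]vp.
Qed.

Lemma entry_lab X Y (f : TYhom R X Y) i j : entry f i j != 0 -> lab i = lab j.
Proof. by rewrite /entry; case: insubP => [p /eqP //|_]; rewrite eqxx. Qed.

(** A summand of X (x) Y is determined by its two components and its label. *)
Lemma tens_inj X Y (p q : TYtens X Y) :
  tfst p = tfst q -> tsnd p = tsnd q -> lab p = lab q -> p = q.
Proof.
case: p q => [[[x y] s] ps] [[[x' y'] s'] qs]; rewrite /tfst /tsnd /= =>
  xx yy ss.
by apply: val_inj; rewrite /= xx yy ss.
Qed.

(** The summand of X (x) Y with components x, y and label s. *)
Definition tens_elt X Y (x : X) (y : Y) (s : option A)
    (xys : s \in fusion (lab x) (lab y)) : TYtens X Y :=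
  exist _ (x, y, s) xys.

Lemma fusionC0 s t : (t \in fusion None s) = (t \in @fusion A s None).
Proof. by case: s. Qed.

Lemma entry_tensm X X' Y Y' (f : TYhom R X X') (g : TYhom R Y Y') p q :
  entry (TYtensm f g) p q = if lab p == lab q then
    entry f (tfst p) (tfst q) * entry g (tsnd p) (tsnd q) else 0.
Proof. by rewrite entry_mkhom. Qed.

Lemma entry_tensm_neq0 X X' Y Y' (f : TYhom R X X') (g : TYhom R Y Y') p q :
  entry (TYtensm f g) p q != 0 -> [/\ lab p = lab q,
    entry f (tfst p) (tfst q) != 0 & entry g (tsnd p) (tsnd q) != 0].
Proof.
rewrite entry_tensm; case: (lab p =P lab q) => [->|_]; last by rewrite eqxx.
by rewrite mulf_eq0 negb_or => /andP[].
Qed.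

Lemma entry_id X i j : entry (TYid R X) i j = (i == j)%:R.
Proof.
by rewrite entry_mkhom; case: (i =P j) => [->|_]; rewrite ?eqxx ?if_same.
Qed.

Lemma entry_comp X Y Z (g : TYhom R Y Z) (f : TYhom R X Y) i k :
  entry (TYcomp g f) i k = \sum_j entry g j k * entry f i j.
Proof.
rewrite entry_mkhom; case: eqP => // nik; rewrite big1 // => j _.
apply/eqP; apply/negPn/negP; rewrite mulf_eq0 negb_or.
by case/andP => /entry_lab jk /entry_lab ij; rewrite ij jk in nik.
Qed.

Lemma entry_comp_neq0 X Y Z (g : TYhom R Y Z) (f : TYhom R X Y) i k :
  entry (TYcomp g f) i k != 0 -> exists2 j, entry g j k != 0 & entry f i j != 0.
Proof.
rewrite entry_comp => nz.
have [j] : exists j, entry g j k * entry f i j != 0.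
  apply/existsP; apply: contraNT nz; rewrite negb_exists => /forallP z.
  by rewrite big1 // => j _; apply/eqP; move: (z j); rewrite negbK.
by rewrite mulf_eq0 negb_or => /andP[? ?]; exists j.
Qed.

(** Composition along a single possible intermediate summand: the way in which
    all composites of structure maps are computed below. *)
Lemma entry_compE X Y Z (g : TYhom R Y Z) (f : TYhom R X Y) i k (j0 : Y) :
  (forall j, entry g j k != 0 -> entry f i j != 0 -> j = j0) ->
  entry (TYcomp g f) i k = entry g j0 k * entry f i j0.
Proof.
move=> uj; rewrite entry_comp (big_only1 j0) // => j /eqP nj _.
apply/eqP; apply/negPn/negP; rewrite mulf_eq0 negb_or.
by case/andP => gj fj; case: nj; apply: uj.
Qed.

End Entries.

(** * The operator E_m^(n) in the Tambara-Yamagami category *)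

Section MPowers.

Variables (R : realType) (A : finGroupType).
Variables (chi : A -> A -> R[i]) (tau : R).

Local Notation M := (TYsimple None : TYob A).

(** mpow n is the power of m with n + 1 factors; the exponent is shifted to
    avoid the power with no factors. *)
Fixpoint mpow (n : nat) : TYob A :=
  if n is n'.+1 then TYtens M (mpow n') else M.

(** The associativity isomorphism from m^(n+1) (x) m to m (x) m^(n+1). *)
Fixpoint mpow_assoc (n : nat) :
    TYhom R (TYtens (mpow n) M) (TYtens M (mpow n)) :=
  if n is n'.+1 then
    TYcomp (TYtensm (TYid R M) (mpow_assoc n')) (TYassoc chi tau M (mpow n') M)
  else TYid R (TYtens M M).

(** mpow_assoc_diag w u is the entry of mpow_assoc n from the summand of label u
    in w (x) m to the summand of label u in m (x) w.  Diagonal entries at n + 1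
    only involve diagonal entries at n. *)
Fixpoint mpow_assoc_diag (n : nat) : mpow n -> option A -> R[i] :=
  if n is n'.+1 then fun (p : TYtens M (mpow n')) u =>
    TYassoc6 chi tau None (lab (tsnd p)) None u (lab p) (lab p)
    * mpow_assoc_diag (tsnd p) (lab p)
  else fun _ _ => 1.

Lemma entry_mpow_assoc n (a : TYtens (mpow n) M) (b : TYtens M (mpow n)) :
  lab a = lab b -> tfst a = tsnd b ->
  entry (mpow_assoc n) a b = mpow_assoc_diag (tfst a) (lab a).
Proof.
elim: n a b => [|n IH] a b lab_ab tab.
  rewrite entry_id (_ : a = b) ?eqxx //.
  by apply: tens_inj lab_ab;
    [case: (tfst a); case: (tfst b) | rewrite -tab; case: (tfst a);
      case: (tsnd a)].
pose a1 : TYtens M (mpow n) := tfst a.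
have Hj1 : lab a1 \in fusion (lab (tsnd a1)) None.
  by rewrite -fusionC0; apply: (valP a1).
pose jk : TYtens (mpow n) M := exist _ (tsnd a1, tt, lab a1) Hj1.
have Hj : lab a \in fusion None (lab jk).
  rewrite fusionC0; exact: (valP a).
pose j0 : TYtens M (TYtens (mpow n) M) := exist _ (tt, jk, lab a) Hj.
rewrite (entry_compE (j0 := j0)); last first.
  move=> j /entry_tensm_neq0[lj _ /entry_lab lj2].
  rewrite entry_mkhom; case: (lab a =P lab j) => [aj|_]; last by rewrite eqxx.
  move=> /=; case: ifP => [c _|_]; last by rewrite eqxx.
  case/andP: c => /eqP wj _.
  apply: (@tens_inj A M (TYtens (mpow n) M)) => //; first by case: (tfst j).
  apply: (@tens_inj A (mpow n) M) => //; first by case: (tsnd (tsnd j)).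
  by rewrite lj2 -tab.
rewrite entry_tensm (_ : lab j0 == lab b); last by apply/eqP; exact: lab_ab.
rewrite entry_id.
have -> : tfst j0 == tfst b by case: (tfst j0); case: (tfst b).
rewrite mul1r IH; first last.
- by rewrite -tab.
- by rewrite -tab.
rewrite entry_mkhom eqxx /=.
by rewrite eqxx mulrC; case: (tsnd a).
Qed.

End MPowers.

Section AbstractRotation.

Variables (K : fieldType) (C : pivotalData K) (V : C).

(** The formula for E_V, with V^(n-1) replaced by any object W and the
    associativity isomorphism by any morphism phi. *)
Definition rot_mor (W : C) (phi : mor (tens W V) (tens V W))
    (f : mor tunit (tens V W)) : mor tunit (tens V W) :=
  mcomp phi (mcomp (tensm (mor1 W) (pivV V))
    (dualB (mcomp (dualA (mcomp (mor1 (tens V W)) f))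
      (mcomp (runitV (dual V)) (lunit (dual V)))))).

(** The trace of rot_mor as a function of the pair (W, phi): both change in the
    induction on the number of factors. *)
Definition rot_trace (p : {W : C & mor (tens W V) (tens V W)}) : K :=
  lfun_trace (linfun (rot_mor (projT2 p))).

Definition rot_step (p : {W : C & mor (tens W V) (tens V W)}) :
    {W : C & mor (tens W V) (tens V W)} :=
  existT (fun W : C => mor (tens W V) (tens V W)) (tens V (projT1 p))
    (mcomp (tensm (mor1 V) (projT2 p)) (assoc V (projT1 p) V)).

Definition rot_base :=
  existT (fun W : C => mor (tens W V) (tens V W)) V (mor1 (tens V V)).

(** The powers of V with their associativity isomorphisms are obtained by
    iterating rot_step, which is free of the special cases of tpow. *)
Lemma FSind_rot n : FSind n.+2 V = rot_trace (iter n rot_step rot_base).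
Proof.
pose pair W phi := existT (fun W : C => mor (tens W V) (tens V W)) W phi.
transitivity (rot_trace (pair _ (tpow_assoc V n.+1))); first by [].
congr rot_trace; elim: n => [|n IH] //=.
by rewrite -IH.
Qed.

End AbstractRotation.

Section Rotation.

Variables (R : realType) (A : finGroupType).
Variables (chi : A -> A -> R[i]) (tau : R).
Local Notation M := (TYsimple None : TYob A).
Local Notation one := (TYone A).

(** The map that dualA attaches to f : 1 -> m (x) W. *)
Definition pairing (W : TYob A) (f : TYhom R one (TYtens M W)) :
    TYhom R (TYtens (TYdual M) one) W :=
  TYcomp (TYcomp (TYcomp (TYlunit R W) (TYtensm (TYev tau M) (TYid R W)))
     (TYassocV chi tau (TYdual M) M W)) (TYtensm (TYid R (TYdual M)) f).

(** The map that dualB attaches to g : 1 (x) m^* -> W. *)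
Definition turned (W : TYob A) (g : TYhom R (TYtens one (TYdual M)) W) :
   TYhom R one (TYtens W (TYdual (TYdual M))) :=
  TYcomp (TYcomp (TYcomp (TYtensm g (TYid R (TYdual (TYdual M))))
     (TYassocV chi tau one (TYdual M) (TYdual (TYdual M))))
     (TYtensm (TYid R one) (TYcoev R (TYdual M)))) (TYrunitV R one).

(** The operator rot_mor for V = m, in terms of the explicit structure maps. *)
Definition rotation (W : TYob A) (phi : TYhom R (TYtens W M) (TYtens M W))
    (f : TYhom R one (TYtens M W)) : TYhom R one (TYtens M W) :=
  TYcomp phi (TYcomp (TYtensm (TYid R W) (TYpivV tau M))
    (turned (TYcomp (pairing (TYcomp (TYid R (TYtens M W)) f))
        (TYcomp (TYrunitV R (TYdual M)) (TYlunit R (TYdual M)))))).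

(** The factor tau^-1 of the evaluation cancels the factor tau of the
    associativity constraint. *)
Lemma entry_pairing W f p (q : TYtens M W) : tau != 0 -> chi 1%g 1%g = 1 ->
  lab q = Some 1%g -> entry (@pairing W f) p (tsnd q) = entry f tt q.
Proof.
move=> tau0 chi1 labq.
have labw : lab (tsnd q) = None.
  have := valP q; rewrite [(val q).2]labq /=; rewrite -/(tsnd q).
  by case: (lab (tsnd q)).
have labp : lab p = None by apply/eqP; exact: (valP p).
have e0 : None \in fusion (lab (tt : TYdual M)) (lab q) by rewrite labq.
(* j0, j1 and j2 are the only intermediate summands that contribute *)
pose j0 : TYtens (TYdual M) (TYtens M W) := tens_elt e0.
have e1' : Some 1%g \in fusion (lab (tt : TYdual M)) (lab (tt : M)) by [].
pose t1 : TYtens (TYdual M) M := tens_elt e1'.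
have e1 : None \in fusion (lab t1) (lab (tsnd q)) by rewrite labw.
pose j1 : TYtens (TYtens (TYdual M) M) W := tens_elt e1.
have e2 : None \in fusion (lab (tt : one)) (lab (tsnd q)) by rewrite labw.
pose j2 : TYtens one W := tens_elt e2.
rewrite /pairing (entry_compE (j0 := j0)); last first.
  move=> j /entry_comp_neq0[j' /entry_comp_neq0[l]].
  rewrite entry_mkhom; case: (lab l =P lab (tsnd q)) => [ll|_];
    last by rewrite eqxx.
  case: (tsnd l =P tsnd q) => [lq _|_]; last by rewrite eqxx.
  case/entry_tensm_neq0 => lj' _.
  rewrite entry_id; case: (tsnd j' =P tsnd l) => [j'l _|_];
    last by rewrite eqxx.
  rewrite entry_mkhom; case: (lab j =P lab j') => [jj'|_]; last by rewrite eqxx.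
  rewrite /=; case: ifP => [c _|_]; last by rewrite eqxx.
  case/entry_tensm_neq0 => pj _ /entry_lab fj.
  apply: (@tens_inj A (TYdual M) (TYtens M W)); first by case: (tfst j).
    apply: (@tens_inj A M W); first by case: (tfst (tsnd j)) (tfst q) => [] [].
      by rewrite -(eqP c) j'l lq.
    by rewrite -fj labq.
  by rewrite -pj labp.
rewrite (entry_compE (j0 := j1)); last first.
  move=> j /entry_comp_neq0[l].
  rewrite entry_mkhom; case: (lab l =P lab (tsnd q)) => [ll|_];
    last by rewrite eqxx.
  case: (tsnd l =P tsnd q) => [lq _|_]; last by rewrite eqxx.
  case/entry_tensm_neq0 => lj' /entry_lab lev.
  rewrite entry_id; case: (tsnd j =P tsnd l) => [j'l _|_]; last by rewrite eqxx.
  move=> _; apply: (@tens_inj A (TYtens (TYdual M) M) W).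
  - apply: (@tens_inj A (TYdual M) M); first by case: (tfst (tfst j)).
      by case: (tsnd (tfst j)).
    by rewrite lev.
  - by rewrite j'l lq.
  - by rewrite lj' ll labw.
rewrite (entry_compE (j0 := j2)); last first.
  move=> j; rewrite entry_mkhom; case: (lab j =P lab (tsnd q)) => [ll|_];
    last by rewrite eqxx.
  case: (tsnd j =P tsnd q) => [lq _|_]; last by rewrite eqxx.
  move=> _; apply: (@tens_inj A one W) => //; first by case: (tfst j).
  by rewrite ll labw.
rewrite entry_mkhom labw eqxx eqxx mul1r.
rewrite 2!entry_tensm entry_id !eqxx mulr1 labp eqxx entry_id mul1r.
rewrite [entry (TYev _ _) _ _]entry_mkhom.
rewrite [entry (TYassocV _ _ _ _ _) _ _]entry_mkhom /=.
rewrite /= [lab (tsnd q)]labw [(sval q).2]labq eqxx; case: (tsnd p).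
rewrite (_ : tsnd j1 == tsnd (tsnd j0)); last exact: eqxx.
by rewrite chi1 mulr1 -(rmorphM (real_complex R)) mulVf // rmorph1 mul1r.
Qed.

Lemma entry_turned W g (q : TYtens W (TYdual (TYdual M))) p :
  lab q = Some 1%g -> entry (@turned W g) tt q = entry g p (tfst q).
Proof.
move=> labq.
have e0' : None \in fusion (lab (tt : one)) (lab (tt : TYdual M)) by [].
pose t0 : TYtens one (TYdual M) := tens_elt e0'.
have e0 : Some 1%g \in fusion (lab t0) (lab (tt : TYdual (TYdual M))) by [].
(* again a single path of summands: j2, then j1, then j0 *)
pose j0 : TYtens (TYtens one (TYdual M)) (TYdual (TYdual M)) := tens_elt e0.
have e1' : Some 1%g \in
    fusion (lab (tt : TYdual M)) (lab (tt : TYdual (TYdual M))) by [].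
pose t1 : TYtens (TYdual M) (TYdual (TYdual M)) := tens_elt e1'.
have e1 : Some 1%g \in fusion (lab (tt : one)) (lab t1) by rewrite /= mulg1 inE.
pose j1 : TYtens one (TYtens (TYdual M) (TYdual (TYdual M))) := tens_elt e1.
have e2 : Some 1%g \in fusion (lab (tt : one)) (lab (tt : one)).
  by rewrite /= mulg1 inE.
pose j2 : TYtens one one := tens_elt e2.
have -> : p = t0.
  apply: (@tens_inj A one (TYdual M)); [by case: (tfst p)|by case: (tsnd p)|].
  by apply/eqP; exact: (valP p).
rewrite /turned (entry_compE (j0 := j2)); last first.
  move=> j _ /entry_lab lj; apply: (@tens_inj A one one); last by rewrite -lj.
    by case: (tfst j).
  by case: (tsnd j).
rewrite (entry_compE (j0 := j1)); last first.
  move=> j _ /entry_tensm_neq0[lj _ /entry_lab lj1].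
  apply: (@tens_inj A one (TYtens (TYdual M) (TYdual (TYdual M)))).
  - by case: (tfst j).
  - apply: (@tens_inj A (TYdual M) (TYdual (TYdual M))).
    + by case: (tfst (tsnd j)).
    + by case: (tsnd (tsnd j)).
    + by rewrite -lj1.
  - by rewrite -lj.
rewrite (entry_compE (j0 := j0)); last first.
  move=> j /entry_tensm_neq0[lj _ _] _.
  apply: (@tens_inj A (TYtens one (TYdual M)) (TYdual (TYdual M))).
  - apply: (@tens_inj A one (TYdual M)).
    + by case: (tfst (tfst j)).
    + by case: (tsnd (tfst j)).
    + by apply/eqP; exact: (valP (tfst j)).
  - by case: (tsnd j).
  - by rewrite lj labq.
rewrite !entry_tensm labq !eqxx !entry_id.
rewrite [entry (TYcoev _ _) _ _]entry_mkhom.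
rewrite [entry (TYassocV _ _ _ _ _) _ _]entry_mkhom.
rewrite [entry (TYrunitV _ _) _ _]entry_mkhom /=.
by rewrite !eqxx; case: (tsnd q); rewrite !mulr1.
Qed.

Lemma swap_subproof W (u : TYtens W M) :
  lab u \in fusion (lab (tt : M)) (lab (tfst u)).
Proof. by rewrite fusionC0; have := valP u; case: (tsnd u). Qed.

(** The summand u of W (x) m, seen as a summand of m (x) W. *)
Definition swap W (u : TYtens W M) : TYtens M W := tens_elt (swap_subproof u).

(** Up to the sign coming from the pivotal structure, the operator only swaps
    the factors and applies phi. *)
Lemma entry_rotation W phi f (v : TYtens M W) : tau != 0 -> chi 1%g 1%g = 1 ->
  entry (@rotation W phi f) tt v =
  \sum_(u : TYtens W M) entry phi u v
    * ((Num.sg tau)%:C%C * entry f tt (swap u)).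
Proof.
move=> tau0 chi1; rewrite /rotation entry_comp; apply: eq_bigr => u _;
  congr (_ * _).
(* a morphism from the unit object vanishes on summands other than the unit *)
have [labu|labu] := altP (lab u =P Some 1%g); last first.
  have z X (h : TYhom R one X) x : lab x != Some 1%g -> entry h tt x = 0.
    move=> nx; apply/eqP; apply: contraNT nx => /entry_lab <-.
    by [].
  by rewrite !z ?mulr0.
have eq0 : Some 1%g \in fusion (lab (tfst u)) (lab (tt : TYdual (TYdual M))).
  by rewrite -labu -fusionC0; exact: (valP (swap u)).
pose q : TYtens W (TYdual (TYdual M)) := tens_elt eq0.
rewrite (entry_compE (j0 := q)); last first.
  move=> j; rewrite entry_tensm; case: (lab j =P lab u) => [lj|_];
    last by rewrite eqxx.
  rewrite entry_id; case: (tfst j =P tfst u) => [tj _ _|_];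
    last by rewrite mul0r eqxx.
  apply: (@tens_inj A W (TYdual (TYdual M))) => //; first by case: (tsnd j).
  by rewrite lj labu.
have ep : None \in fusion (lab (tt : one)) (lab (tt : TYdual M)) by [].
pose p : TYtens one (TYdual M) := tens_elt ep.
have ep' : None \in fusion (lab (tt : TYdual M)) (lab (tt : one)) by [].
pose p' : TYtens (TYdual M) one := tens_elt ep'.
rewrite (entry_turned _ p) // entry_tensm labu eqxx entry_id eqxx mul1r.
congr (_ * _).
  by rewrite entry_mkhom /=; case: (tsnd u).
rewrite (entry_compE (j0 := p')); last first.
  move=> j _ _; apply: (@tens_inj A (TYdual M) one).
  - by case: (tfst j).
  - by case: (tsnd j).
  - by apply/eqP; exact: (valP j).
rewrite (@entry_pairing W _ p' (swap u)) //
  (entry_compE (j0 := (tt : TYdual M))); last by case.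
rewrite (entry_compE (j0 := swap u)); last first.
  by move=> j; rewrite entry_id; case: (j =P swap u) => [//|_]; rewrite eqxx.
rewrite entry_id eqxx mul1r.
by rewrite !entry_mkhom /= !mulr1.
Qed.

End Rotation.

Section IndicatorSum.

Variables (R : realType) (A : finGroupType).
Variables (chi : A -> A -> R[i]) (tau : R).
Local Notation M := (TYsimple None : TYob A).
Local Notation TYC := (TY chi tau).
Local Notation one := (TYone A).

Lemma big_sig (K : nmodType) (I : finType) (P : pred I) (F : I -> K) :
  \sum_(i | P i) F i = \sum_(x : {i | P i}) F (val x).
Proof.
rewrite (reindex_omap (val : {i | P i} -> I) insub) => [|i Pi].
  by apply: eq_bigl => -[i Pi] /=; rewrite insubT Pi /= eqxx.
by rewrite insubT.
Qed.

Lemma big_tens (X Y : TYob A) (G : X -> Y -> option A -> R[i]) :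
  \sum_(p : TYtens X Y) G (tfst p) (tsnd p) (lab p) =
  \sum_x \sum_y \sum_(s | s \in fusion (lab x) (lab y)) G x y s.
Proof.
pose P (t : X * Y * option A) := t.2 \in fusion (lab t.1.1) (lab t.1.2).
rewrite pair_bigA pair_big_dep /=.
transitivity (\sum_(t | P t) G t.1.1 t.1.2 t.2).
  by rewrite [RHS]big_sig.
by apply: eq_bigl.
Qed.

Lemma rotation_trace_diag (W : TYob A)
    (phi : TYhom R (TYtens W M) (TYtens M W)) :
  tau != 0 -> chi 1%g 1%g = 1 ->
  \sum_(i : {p : one * TYtens M W | lab p.1 == lab p.2})
     (rotation chi tau phi [ffun j => (j == i)%:R]) i =
  (Num.sg tau)%:C%C
    * \sum_(u : TYtens W M | lab u == Some 1%g) entry phi u (swap u).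
Proof.
move=> tau0 chi1.
pose P (t : one * TYtens M W) := lab t.1 == lab t.2.
pose e (v : TYtens M W) : TYhom R one (TYtens M W) :=
  mkhom (fun _ w => (w == v)%:R).
transitivity (\sum_(i : {t | P t})
                 entry (rotation chi tau phi (e (val i).2)) tt (val i).2).
  apply: eq_bigr => i _.
  have -> : e (val i).2 = [ffun j => (j == i)%:R].
    by apply/ffunP => j; rewrite !ffunE; congr (nat_of_bool _)%:R.
  rewrite /entry; case: insubP => [u _ ui|]; last first.
    by have := valP i; rewrite /P; case: (val i) => [[] v] /= ->.
  rewrite /=; congr (rotation _ _ _ _ _); apply: val_inj.
  by rewrite ui; case: (val i) => [[] ?].
rewrite -(big_sig P (fun t => entry (rotation chi tau phi (e t.2)) tt t.2)).
transitivity (\sum_(t : one * TYtens M W |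
                     (t.1 \in [set: one]) && (lab t.2 == Some 1%g))
                 entry (rotation chi tau phi (e t.2)) tt t.2).
  by apply: eq_bigl => -[x y]; rewrite inE /P eq_sym.
rewrite -(pair_big_dep (fun x => x \in [set: one])
  (fun _ y => lab y == Some 1%g)
    (fun _ y => entry (rotation chi tau phi (e y)) tt y)).
rewrite (big_only1 tt) //.
under eq_bigr => v lv.
  rewrite entry_rotation //.
  under eq_bigr do rewrite entry_mkhom.
  over.
rewrite exchange_big mulr_sumr [RHS]big_mkcond; apply: eq_bigr => u _.
have lsu : lab (swap u) = lab u by [].
case: ifP => lu; last first.
  by rewrite big1 // => v _; rewrite lsu [_ == lab u]eq_sym lu !mulr0.
rewrite (big_only1 (swap u)) ?lsu //.
  by rewrite (eqP lu) !eqxx mulr1 mulrC.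
by move=> v /negbTE nv _; rewrite [swap u == v]eq_sym nv if_same !mulr0.
Qed.

Lemma lab_tens (X Y : TYob A) (p : TYtens X Y) :
  lab p \in fusion (lab (tfst p)) (lab (tsnd p)).
Proof. exact: (valP p). Qed.

(** An odd power of m is a sum of copies of m. *)
Lemma lab_mpow_even j (w : mpow A j.*2) : lab w = None.
Proof.
elim: j w => [|j IH] // w.
pose w1 : TYtens M (TYtens M (mpow A j.*2)) := w.
have := lab_tens (tsnd w1); have := lab_tens w1; rewrite IH.
rewrite -[lab w]/(lab w1) -[lab (tfst w1)]/None -[lab (tfst _)]/None.
case: (lab (tsnd w1)) => [a|] //= labw _.
exact/eqP.
Qed.

(** The sum of diagonal entries that computes the indicator; y plays the role of
    the preceding label x_(i-1). *)
Fixpoint indicator_sum n (y : A) : R[i] :=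
  if n is n'.+1 then
    \sum_x chi x y * (tau%:C%C * (chi x x)^-1) * indicator_sum n' x
  else 1.

Lemma sum_option (F : option A -> R[i]) (P : pred (option A)) :
  \sum_(s | P s) F s =
  (if P None then F None else 0) + \sum_(x | P (Some x)) F (Some x).
Proof.
rewrite big_mkcond (bigD1 None) //=; congr (_ + _).
rewrite (reindex_omap Some id) //=; last by case.
by rewrite [RHS]big_mkcond /=; apply: eq_bigl => x /=; rewrite eqxx.
Qed.

(** Two steps at a time: an odd power of m only has summands m, and tensoring
    each with m yields every element x of A once, the next summation index. *)
Lemma mpow_assoc_diag_sum j y :
  \sum_(w : mpow A j.*2) mpow_assoc_diag chi tau w (Some y) = indicator_sum j y.
Proof.
elim: j y => [|j IH] y; first by rewrite /= big_const card_unit /= addr0.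
pose W := mpow A j.*2.
(* the label s of a summand of m (x) p, for p in m (x) W, can only be m, and
   that of a summand of m (x) w, for w in W, is any element x of A *)
pose G1 (_ : M) (p : TYtens M W) (s : option A) :=
   TYassoc6 chi tau None (lab p) None (Some y) s s
     * mpow_assoc_diag chi tau (p : mpow A j.*2.+1) s.
pose G2 (_ : M) (w : W) (s : option A) :=
  (if s is Some x then chi x y else 0)
  * (TYassoc6 chi tau None (lab w) None None s s * mpow_assoc_diag chi tau w s).
transitivity (\sum_(p : TYtens M (TYtens M W)) G1 (tfst p) (tsnd p) (lab p))
  => //.
rewrite big_tens (big_only1 tt) //.
transitivity (\sum_(p : TYtens M W) G2 (tfst p) (tsnd p) (lab p)).
  apply: eq_bigr => p _; have := lab_tens p;
    rewrite [lab (tsnd p)]lab_mpow_even.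
  rewrite sum_option; case labp: (lab p) => [a|] //= _.
  rewrite big_pred0 ?addr0 // /G1 /G2 labp; congr (_ * _).
  have -> : mpow_assoc_diag chi tau (p : mpow A j.*2.+1) None =
    TYassoc6 chi tau None (lab (tsnd p)) None None (lab p) (lab p)
    * mpow_assoc_diag chi tau (tsnd p) (lab p) by [].
  by rewrite labp.
rewrite big_tens (big_only1 tt) //.
transitivity (\sum_(w : W) \sum_x chi x y * (tau%:C%C * (chi x x)^-1)
  * mpow_assoc_diag chi tau w (Some x)).
  apply: eq_bigr => w _; rewrite sum_option /G2 !lab_mpow_even add0r.
  by apply: eq_big => // x _; rewrite /= mulrA.
by rewrite exchange_big; apply: eq_bigr => x _; rewrite -mulr_sumr IH.
Qed.

Lemma rotation_is_linear (W : TYob A)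
    (phi : TYhom R (TYtens W M) (TYtens M W)) :
  linear (rotation chi tau phi).
Proof.
move=> a f g; rewrite /rotation /turned /pairing.
by rewrite !(TYcomp_linearr, TYtensm_linearr, TYcomp_linearl, TYtensm_linearl).
Qed.

Lemma rotation_trace (W : TYob A) (phi : TYhom R (TYtens W M) (TYtens M W)) :
  tau != 0 -> chi 1%g 1%g = 1 ->
  lfun_trace (linfun (rotation chi tau phi)) =
  (Num.sg tau)%:C%C
    * \sum_(u : TYtens W M | lab u == Some 1%g) entry phi u (swap u).
Proof.
move=> tau0 chi1; rewrite -(rotation_trace_diag _ tau0 chi1).
exact: (lfun_trace_linfun (rotation_is_linear phi)).
Qed.

Local Notation endo := {W : TYob A & TYhom R (TYtens W M) (TYtens M W)}.

Lemma rot_stepE (p : endo) :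
  @rot_step _ TYC (TYm chi tau) p =
  existT _ (TYtens M (projT1 p))
    (TYcomp (TYtensm (TYid R M) (projT2 p)) (TYassoc chi tau M (projT1 p) M))
      :> endo.
Proof. by []. Qed.

Lemma rot_iter n :
  iter n (@rot_step _ TYC (TYm chi tau)) (rot_base (TYm chi tau)) =
  existT _ (mpow A n) (mpow_assoc chi tau n) :> endo.
Proof. by elim: n => [|n IH] //; rewrite iterS IH rot_stepE. Qed.

Lemma rot_traceE (p : endo) : @rot_trace _ TYC (TYm chi tau) p =
  lfun_trace (linfun (rotation chi tau (projT2 p))).
Proof. by []. Qed.

Lemma FSind_indicator_sum j : tau != 0 -> chi 1%g 1%g = 1 ->
  FSind j.*2.+2 (TYm chi tau) = (Num.sg tau)%:C%C * indicator_sum j 1%g.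
Proof.
move=> tau0 chi1; rewrite FSind_rot rot_iter rot_traceE rotation_trace //.
congr (_ * _); rewrite -mpow_assoc_diag_sum.
pose W := mpow A j.*2.
pose G (w : W) (_ : M) (s : option A) :=
  if s == Some 1%g then mpow_assoc_diag chi tau w s else 0.
transitivity (\sum_(u : TYtens W M) G (tfst u) (tsnd u) (lab u)).
  rewrite big_mkcond; apply: eq_bigr => u _; rewrite /G; case: ifP => // lu.
  by rewrite entry_mpow_assoc.
rewrite big_tens; apply: eq_bigr => w _.
rewrite (big_only1 tt) // sum_option lab_mpow_even add0r.
rewrite (big_only1 1%g) /G ?eqxx //= => a /negbTE na _.
by rewrite (_ : (Some a == Some 1%g) = false).
Qed.

End IndicatorSum.

(** * -1 is a sum of four squares modulo N *)

Section FourSquares.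

Local Open Scope nat_scope.

Lemma solve_lin_mod u p q : 0 < p -> coprime u p -> exists t, p %| q + u * t.
Proof.
move=> p0 cup; have := chinese_modl cup 0 (p.-1 * q); have :=
  chinese_modr cup 0 (p.-1 * q).
set x := chinese _ _ _ _ => xp xu.
have /dvdnP[t xt] : u %| x by rewrite /dvdn xu mod0n.
exists t; rewrite mulnC -xt /dvdn -modnDmr xp modnDmr -mulSn prednK //.
by rewrite modnMr.
Qed.

(** The h + 1 squares and the h + 1 elements -1 - j^2 of F_p, for p = 2h + 1,
    cannot all be distinct. *)
Lemma two_squares_prime p : prime p -> odd p ->
  exists a b, p %| a ^ 2 + b ^ 2 + 1.
Proof.
move=> pp po; pose h := p./2.
have ph : p = h.*2.+1 by rewrite -[LHS]odd_double_half po.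
have cp := pchar_Fp pp.
pose f (s : 'I_h.+1 + 'I_h.+1) : 'F_p :=
  match s with inl i => (i%:R ^+ 2)%R | inr j => (- 1 - j%:R ^+ 2)%R end.
have sq_inj (i j : 'I_h.+1) : (i%:R ^+ 2 = j%:R ^+ 2 :> 'F_p)%R -> i = j.
  move=> /eqP; rewrite -GRing.subr_eq0 GRing.subr_sqr GRing.mulf_eq0 => ij;
    apply: val_inj => /=.
  have := ltn_ord i; have := ltn_ord j; rewrite !ltnS => jh ih.
  case/orP: ij.
    wlog ij : i j ih jh / j <= i.
      case: (leqP j i) => ij W; first exact: W.
      by rewrite -GRing.oppr_eq0 GRing.opprB => ?; apply/esym/W => //;
        apply: ltnW.
    rewrite -GRing.natrB // -(dvdn_pcharf cp) => /dvdn_leq.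
    by lia.
  by rewrite -GRing.natrD -(dvdn_pcharf cp) => /dvdn_leq; lia.
have [/existsP[i /existsP[j /eqP ij]]|] :=
  boolP [exists i, exists j, f (inl i) == f (inr j)].
  exists i, j; rewrite (dvdn_pcharf cp) !GRing.natrD !GRing.natrX.
  by move: ij; rewrite /f => ->; apply/eqP; ring.
move=> nij; suff /leq_card : injective f.
  by rewrite card_sum !card_ord Fp_cast // ph; lia.
move=> [i|i] [j|j].
- by move=> /sq_inj ->.
- by move=> /eqP ij; case/existsP: nij; exists i; apply/existsP; exists j.
- by move=> /esym/eqP ij; case/existsP: nij; exists j; apply/existsP; exists i.
- by move=> /GRing.addrI/GRing.oppr_inj/sq_inj ->.
Qed.

(** Hensel lifting in a, which is kept prime to p. *)
Lemma two_squares_odd_prime_pow p e : prime p -> odd p ->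
  exists a b, p ^ e.+1 %| a ^ 2 + b ^ 2 + 1 /\ ~~ (p %| a).
Proof.
move=> pp po; elim: e => [|e [a [b [/dvdnP[q Sq] pa]]]].
  have [a [b ab]] := two_squares_prime pp po; rewrite expn1.
  have [pa|pa] := boolP (p %| a); last by exists a, b.
  have [pb|pb] := boolP (p %| b); last by exists b, a; rewrite [b ^ 2 + _]addnC.
  move: ab; rewrite dvdn_addr ?dvdn_add ?dvdn_exp // dvdn1 => /eqP p1.
  by rewrite p1 in pp.
have cap : coprime (2 * a) p.
  by rewrite coprimeMl coprime_sym coprimen2 po coprime_sym prime_coprime.
have [t /dvdnP[r tr]] := solve_lin_mod q (prime_gt0 pp) cap.
exists (a + t * p ^ e.+1), b; split; last first.
  by rewrite dvdn_addl // dvdn_mull // expnS dvdn_mulr.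
apply/dvdnP; exists (r + t ^ 2 * p ^ e).
rewrite [p ^ e.+2]expnS mulnA mulnDl -tr.
have -> : (a + t * p ^ e.+1) ^ 2 + b ^ 2 + 1
  = a ^ 2 + b ^ 2 + 1 + (2 * a * t + t ^ 2 * p ^ e.+1) * p ^ e.+1 by ring.
by rewrite Sq [p ^ e.+1]expnS; ring.
Qed.

(** -7 is a square modulo any power of 2, so -1 = 2^2 + 1^2 + 1^2 + d^2. *)
Lemma odd_square_pow2 e : exists d, odd d /\ 2 ^ e.+3 %| d ^ 2 + 7.
Proof.
elim: e => [|e [d [od /dvdnP[q dq]]]]; first by exists 1.
have [oq|eq] := boolP (odd q); last first.
  by exists d; split=> //; rewrite dq expnS dvdn_mul // dvdn2 eq.
exists (d + 2 ^ e.+2); split; first by rewrite oddD od oddX.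
have -> : (d + 2 ^ e.+2) ^ 2 + 7 = d ^ 2 + 7 + (d + 2 ^ e.+1) * 2 ^ e.+3.
  by rewrite !expnS; ring.
by rewrite dq -mulnDl [2 ^ e.+4]expnS dvdn_mul // dvdn2 !oddD oq od oddX.
Qed.

(** -1 is a sum of four squares modulo N. *)
Definition neg1_four_squares N := exists a b c d,
  N %| a ^ 2 + b ^ 2 + c ^ 2 + d ^ 2 + 1.

Lemma neg1_four_squares_coprime m n : coprime m n ->
  neg1_four_squares m -> neg1_four_squares n -> neg1_four_squares (m * n).
Proof.
move=> cmn [a [b [c [d mS]]]] [a' [b' [c' [d' nS]]]].
pose ch := chinese m n.
exists (ch a a'), (ch b b'), (ch c c'), (ch d d').
have sq k x y : x = y %[mod k] -> x ^ 2 = y ^ 2 %[mod k].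
  by move=> xy; rewrite -modnXm xy modnXm.
have ad k x y z t : x = y %[mod k] -> z = t %[mod k] -> x + z = y + t %[mod k].
  by move=> xy zt; rewrite -modnDm xy zt modnDm.
rewrite Gauss_dvd //; apply/andP; split.
  rewrite /dvdn; apply/eqP; rewrite -[RHS](eqP mS).
  by apply: (ad _) => //; apply: (ad _); [apply: (ad _); [apply: (ad _)|]|];
    apply: (sq _); exact: chinese_modl.
rewrite /dvdn; apply/eqP; rewrite -[RHS](eqP nS).
by apply: (ad _) => //; apply: (ad _); [apply: (ad _); [apply: (ad _)|]|];
  apply: (sq _); exact: chinese_modr.
Qed.

Lemma neg1_four_squares_dvd m n : m %| n -> neg1_four_squares n ->
  neg1_four_squares m.
Proof. by move=> mn [a [b [c [d nS]]]]; exists a, b, c, d;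
  apply: dvdn_trans nS. Qed.

Lemma neg1_four_squares_prime_pow p e : prime p -> neg1_four_squares (p ^ e).
Proof.
move=> pp; case: (even_prime pp) => [->|po].
  apply: (@neg1_four_squares_dvd _ (2 ^ e.+3));
    first by rewrite dvdn_exp2l // ltnW // ltnW.
  have [d [_ d7]] := odd_square_pow2 e; exists d, 2, 1, 1.
  by rewrite -!addnA.
apply: (@neg1_four_squares_dvd _ (p ^ e.+1)); first by rewrite dvdn_exp2l.
have [a [b [ab _]]] := two_squares_odd_prime_pow e pp po.
by exists a, b, 0, 0; rewrite !addn0.
Qed.

Lemma neg1_four_squares_gt0 N : 0 < N -> neg1_four_squares N.
Proof.
elim/ltn_ind: N => N IH N0; have [N1|N1] := leqP N 1.
  by exists 0, 0, 0, 0; move: N N0 N1 {IH} => [|[|]].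
have pp := pdiv_prime N1; set p := pdiv N in pp.
rewrite -(partnC p N0); apply: neg1_four_squares_coprime.
- exact: coprime_partC.
- by rewrite p_part; apply: neg1_four_squares_prime_pow.
- apply: IH; last exact: part_gt0.
  rewrite -[X in _ < X](partnC p N0) ltn_Pmull ?part_gt0 // p_part.
  by rewrite -{1}(exp1n (logn p N)) ltn_exp2r ?prime_gt1 // logn_gt0 mem_primes
    pp N0 pdiv_dvd.
Qed.

End FourSquares.

(** * Gauss sums of biadditive forms *)

HB.instance Definition _ (I : finType) (V : finZmodType) :=
  GRing.Zmodule.on {ffun I -> V}.

Lemma mulrn_card (V : finZmodType) (x : V) : x *+ #|V| = 0.
Proof.
have := expg_cardG (in_setT x).
by rewrite cardsT FinRing.zmodXgE.
Qed.

(** Bicharacters of an additively written group. *)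
Definition biadditive (V : zmodType) (F : fieldType) (B : V -> V -> F) : Prop :=
  [/\ forall x y, B x y != 0,
      forall x y z, B (x + y) z = B x z * B y z
    & forall x y z, B x (y + z) = B x y * B x z].

Section Biadditive.
Variables (V : finZmodType) (F : fieldType) (B : V -> V -> F).
Hypothesis B_bi : biadditive B.

Lemma bi_neq0 x y : B x y != 0. Proof. by case: B_bi. Qed.
Lemma bi_addl x y z : B (x + y) z = B x z * B y z. Proof. by case: B_bi. Qed.
Lemma bi_addr x y z : B x (y + z) = B x y * B x z. Proof. by case: B_bi. Qed.

Lemma bi_0l y : B 0 y = 1.
Proof. by apply: (mulfI (bi_neq0 0 y)); rewrite -bi_addl addr0 mulr1. Qed.
Lemma bi_0r x : B x 0 = 1.
Proof. by apply: (mulfI (bi_neq0 x 0)); rewrite -bi_addr addr0 mulr1. Qed.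

Lemma bi_oppl x y : B (- x) y = (B x y)^-1.
Proof. by apply: (mulfI (bi_neq0 x y));
  rewrite -bi_addl subrr bi_0l divff ?bi_neq0. Qed.
Lemma bi_oppr x y : B x (- y) = (B x y)^-1.
Proof. by apply: (mulfI (bi_neq0 x y));
  rewrite -bi_addr subrr bi_0r divff ?bi_neq0. Qed.

Lemma bi_mulnl x y n : B (x *+ n) y = B x y ^+ n.
Proof. by elim: n => [|n IH]; rewrite ?bi_0l // mulrS bi_addl IH exprS. Qed.
Lemma bi_mulnr x y n : B x (y *+ n) = B x y ^+ n.
Proof. by elim: n => [|n IH]; rewrite ?bi_0r // mulrS bi_addr IH exprS. Qed.

Lemma bi_mulzl x y (n : int) : B (x *~ n) y = B x y ^ n.
Proof.
case: n => n; first by rewrite -pmulrn bi_mulnl.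
by rewrite NegzE mulrNz -pmulrn bi_oppl bi_mulnl -exprnN.
Qed.
Lemma bi_mulzr x y (n : int) : B x (y *~ n) = B x y ^ n.
Proof.
case: n => n; first by rewrite -pmulrn bi_mulnr.
by rewrite NegzE mulrNz -pmulrn bi_oppr bi_mulnr -exprnN.
Qed.

Lemma bi_suml I (r : seq I) (x : I -> V) y : B (\sum_(i <- r) x i) y
  = \prod_(i <- r) B (x i) y.
Proof. exact: (big_morph (B^~ y) (fun u v => bi_addl u v y) (bi_0l y)). Qed.
Lemma bi_sumr I (r : seq I) x (y : I -> V) : B x (\sum_(i <- r) y i)
  = \prod_(i <- r) B x (y i).
Proof. exact: (big_morph (B x) (bi_addr x) (bi_0r x)). Qed.

Lemma bi_card x y : B x y ^+ #|V| = 1.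
Proof. by rewrite -bi_mulnl mulrn_card bi_0l. Qed.

End Biadditive.

Lemma exprz_sum (F : fieldType) (z : F) I (r : seq I) (m : I -> int) : z != 0 ->
  z ^ (\sum_(i <- r) m i) = \prod_(i <- r) z ^ m i.
Proof.
by move=> z0; elim/big_rec2: _ => [|i u v _ <-]; rewrite ?expr0z // expfzDr.
Qed.

Lemma prod_exprz (F : fieldType) I (r : seq I) (z : I -> F) (n : int) :
  (\prod_(i <- r) z i) ^ n = \prod_(i <- r) z i ^ n.
Proof.
by elim/big_rec2: _ => [|i u v _ <-]; rewrite ?exp1rz // expfzMl.
Qed.

Section Quadratic.
Variables (F : numClosedFieldType).

(** The sum of the quadratic function x |-> B(x, x). *)
Definition gauss_sum (V : finZmodType) (B : V -> V -> F) : F := \sum_x B x x.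

Variables (V : finZmodType) (B : V -> V -> F).
Hypothesis B_bi : biadditive B.

Lemma root_of_unity_conj n (z : F) : (0 < n)%N -> z ^+ n = 1 -> z^* = z^-1.
Proof.
move=> n0 zn; have nz : `|z| = 1.
  by apply/eqP; rewrite -(pexpr_eq1 n0) ?normr_ge0 // -normrX zn normr1.
by rewrite invC_norm nz expr1n invr1 mul1r.
Qed.

Lemma card_zmod_gt0 : (0 < #|V|)%N.
Proof. by apply/card_gt0P; exists 0. Qed.

Lemma bi_conj x y : (B x y)^* = (B x y)^-1.
Proof. exact: root_of_unity_conj card_zmod_gt0 (bi_card B_bi x y). Qed.

Lemma conj_gauss_sum : (gauss_sum B)^* = \sum_x (B x x)^-1.
Proof. by rewrite rmorph_sum; apply: eq_bigr => x _; rewrite /= bi_conj. Qed.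

(** An integer matrix M such that M^T M is the scalar -1 modulo |V| permutes V^k
    and inverts the product of the B(x_i, x_i). *)
Lemma gauss_sum_orthogonal k (M : 'I_k -> 'I_k -> int) (t : int) :
  (forall i j, \sum_r M r i * M r j = (i == j)%:R * (t * #|V| - 1)) ->
  gauss_sum B ^+ k = (gauss_sum B)^* ^+ k.
Proof.
move=> hM; pose L (x : {ffun 'I_k -> V}) : {ffun 'I_k -> V} :=
  [ffun r => \sum_i x i *~ M r i].
have neg x : x *~ (t * #|V| - 1) = - x :> V.
  by rewrite mulrzBr mulrzA mulrzAC -pmulrn mulrn_card mul0rz sub0r.
have L_inj : injective L.
  apply: (can_inj (g := fun y : {ffun _ -> V} =>
    [ffun j => - \sum_r y r *~ M r j])) => x.
  apply/ffunP => j; rewrite ffunE.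
  transitivity (- \sum_i x i *~ ((i == j)%:R * (t * #|V| - 1))).
    congr (- _); under eq_bigr => r _ do rewrite ffunE mulrz_suml.
    rewrite exchange_big; apply: eq_bigr => i _.
    by rewrite -hM mulrz_sumr; apply: eq_bigr => r _; rewrite mulrzA.
  rewrite (bigD1 j) //= big1 => [|i /negbTE ->]; last by rewrite mul0r mulr0z.
  by rewrite eqxx mul1r neg addr0 opprK.
have expand (f : V -> F) : (\sum_x f x) ^+ k
  = \sum_(x : {ffun 'I_k -> V}) \prod_i f (x i).
  transitivity (\prod_(i < k) \sum_x f x);
    first by rewrite prodr_const card_ord.
  by rewrite (bigA_distr_bigA (fun _ => f)).
rewrite conj_gauss_sum !expand (reindex_inj L_inj); apply: eq_bigr => x _.
transitivity (\prod_i \prod_j B (x i) (x j) ^ (\sum_r M r i * M r j)).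
  under eq_bigr => r _.
    rewrite ffunE bi_suml //; under eq_bigr => i _.
      rewrite bi_mulzl // bi_sumr //; under eq_bigr =>
        j _ do rewrite bi_mulzr //.
      over.
    over.
  rewrite exchange_big; apply: eq_bigr => i _.
  under eq_bigr => j _ do rewrite prod_exprz.
  rewrite exchange_big; apply: eq_bigr => j _.
  rewrite exprz_sum ?bi_neq0 //; apply: eq_bigr => r _.
  by rewrite exprz_exp mulrC.
apply: eq_bigr => i _; rewrite [LHS](bigD1 i) //= [X in _ * X]big1 => [|j];
  last first.
  by rewrite hM eq_sym => /negbTE ->; rewrite mul0r expr0z.
by rewrite hM eqxx mul1r mulr1 -bi_mulzl // neg bi_oppl.
Qed.

(** The matrix of left multiplication by a + bi + cj + dk. *)
Definition quaternion_mx (a b c d : int) (r i : 'I_4) : int :=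
  nth 0 (nth [::] [:: [:: a; - b; - c; - d]; [:: b; a; - d; c];
                      [:: c; d; a; - b]; [:: d; - c; b; a]] r) i.

Lemma gauss_sum_exp4 : gauss_sum B ^+ 4 = (gauss_sum B)^* ^+ 4.
Proof.
have [a [b [c [d /dvdnP[t tS]]]]] := neg1_four_squares_gt0 card_zmod_gt0.
apply: (@gauss_sum_orthogonal _ (quaternion_mx a b c d) t).
have -> : t%:Z * #|V| - 1 = a%:Z ^+ 2 + b%:Z ^+ 2 + c%:Z ^+ 2 + d%:Z ^+ 2.
  by rewrite -PoszM -tS; lia.
rewrite /quaternion_mx.
by case=> [[|[|[|[|]]]] //] ?; case=> [[|[|[|[|]]]] //] ?;
  rewrite !big_ord_recl big_ord0 /=; ring.
Qed.

(** Replace x by x + y in the double sum of B(x, x) / B(y, y). *)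
Lemma gauss_sum_norm :
  gauss_sum B * (gauss_sum B)^* = \sum_x B x x * \sum_y B x y * B y x.
Proof.
rewrite conj_gauss_sum mulr_sumr.
transitivity (\sum_y \sum_x B x x * (B x y * B y x)); last first.
  by rewrite exchange_big; apply: eq_bigr => x _; rewrite mulr_sumr.
apply: eq_bigr => y _; rewrite mulr_suml (reindex_inj (addIr y)) /=.
apply: eq_bigr => x _; rewrite !(bi_addl, bi_addr) //.
by have := bi_neq0 B_bi y y => ?; field.
Qed.

End Quadratic.

(** * Gauss sums over groups of odd order *)

Section Integral.
Variable F : numFieldType.
Local Notation integral := (integralOver (intr : int -> F)).

(** Clear denominators in a monic equation for z: then 2 divides m ^ d. *)
Lemma integral_half_even (z : F) (m : int) : integral z -> 2 * z = m%:~R ->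
  (2 %| m)%Z.
Proof.
case=> p mon_p root_p zm.
pose d := (size p).-1.
have sp : size p = d.+1 by rewrite prednK // size_poly_gt0 monic_neq0.
have pd : p`_d = 1 by apply/eqP.
pose S : int := \sum_(i < d) p`_i * m ^+ i * 2 ^+ (d - i.+1).
have mS : m ^+ d = - (2 * S).
  apply: (@intr_inj F); rewrite rmorphXn /= rmorphN rmorphM /=.
  apply/eqP; rewrite -addr_eq0 -zm; apply/eqP.
  transitivity (2 ^+ d * (map_poly intr p).[z]); last first.
    by rewrite (eqP root_p) mulr0.
  rewrite horner_coef size_map_inj_poly ?sp //; last exact: intr_inj.
  rewrite big_ord_recr /= coef_map /= pd mul1r mulrDr addrC exprMn;
    congr (_ + _).
  rewrite /S rmorph_sum !mulr_sumr; apply: eq_bigr => i _.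
  rewrite !rmorphM !rmorphXn /= coef_map /= -zm exprMn.
  have -> : (2 : F) ^+ d = 2 ^+ i * 2 ^+ (d - i.+1) * 2.
    by rewrite -exprD -exprSr; congr (_ ^+ _); have := ltn_ord i; lia.
  by ring.
have [d0|d0] := posnP d.
  by move: mS; rewrite d0 /S; lia.
have : (2 %| m ^+ d)%Z by rewrite mS dvdzE abszN abszM dvdn_mulr.
by rewrite !dvdzE abszX Euclid_dvdX // => /andP[].
Qed.

Lemma integral_sum I (r : seq I) (P : pred I) (f : I -> F) :
  (forall i, P i -> integral (f i)) -> integral (\sum_(i <- r | P i) f i).
Proof.
by move=> If; elim/big_ind: _ => //; [exact: integral0 | exact: integral_add].
Qed.

Lemma integral_root_of_unity n (z : F) : (0 < n)%N -> z ^+ n = 1 -> integral z.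
Proof.
move=> n0 zn; exists ('X^n - 1); first exact: monicXnsubC.
by rewrite rmorphB /= map_polyXn rmorph1 rootE !hornerE zn subrr.
Qed.

Lemma integral_quarter (z : F) (m : int) : integral z -> 4 * z = m%:~R ->
  (4 %| m)%Z.
Proof.
move=> Iz zm; have Iz2 : integral (2 * z) by apply: integral_mul => //;
  exact: (integral_nat _ 2).
have /dvdzP[m' mm'] : (2 %| m)%Z by apply: integral_half_even Iz2 _;
  rewrite -zm; ring.
have : (2 %| m')%Z.
  apply: integral_half_even Iz _; apply: (mulfI (_ : (2 : F) != 0));
    first by rewrite pnatr_eq0.
  by rewrite mulrA -natrM zm mm' rmorphM /= mulrC.
by move=> /dvdzP[m'' mm'']; apply/dvdzP; exists m''; rewrite mm' mm'' -mulrA.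
Qed.
End Integral.

Section Odd.
Variables (F : numClosedFieldType) (V : finZmodType) (B : V -> V -> F).
Hypothesis B_bi : biadditive B.
Hypothesis V_odd : odd #|V|.

(** As |V| is odd, only 0 is its own opposite, and B(x, x) = B(-x, -x). *)
Lemma gauss_sum_mod2 : exists2 s, integralOver (intr : int -> F) s &
  gauss_sum B = 1 + 2 * s.
Proof.
(* P selects one element of each pair {x, - x} with x nonzero *)
pose P (x : V) := (enum_rank x < enum_rank (- x)%R)%N.
exists (\sum_(x | P x) B x x).
  apply: integral_sum => x _; apply: integral_root_of_unity (card_zmod_gt0 V) _.
  exact: bi_card.
have fixN (x : V) : - x = x -> x = 0.
  move=> /eqP; rewrite -subr_eq0 -opprD oppr_eq0 -mulr2n => /eqP x2.
  have := mulrn_card x; rewrite -(odd_double_half #|V|) V_odd -mul2n mulrnDr.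
  by rewrite mulr1n mulrnA x2 mul0rn addr0.
rewrite /gauss_sum (bigID P) /= [X in _ + X](bigD1 0) /=; last first.
  by rewrite /P oppr0 ltnn.
rewrite bi_0l // addrC -addrA; congr (_ + _); rewrite mulr2n mulrDl mul1r;
  congr (_ + _).
rewrite [RHS](reindex_inj oppr_inj) /=; apply: eq_big => [x|x _].
  rewrite /P opprK; apply/andP/idP => [[Px x0]|Px].
    rewrite ltn_neqAle leqNgt Px andbT; apply: contraNneq x0 => e.
    by apply/eqP/fixN/enum_rank_inj/val_inj.
  split; first by rewrite -leqNgt ltnW.
  by apply: contraTneq Px => ->; rewrite oppr0 ltnn.
by rewrite bi_oppl // bi_oppr // invrK.
Qed.

(** T ^ 4 = - D ^ 2 is excluded because T ^ 4 is 1 and D ^ 2 is 1 modulo 4. *)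
Lemma gauss_sum_odd_sqr (D : nat) : odd D ->
  gauss_sum B * (gauss_sum B)^* = D%:R ->
  ((D = 1 %[mod 4])%N -> gauss_sum B ^+ 2 = D%:R) /\
  ((D <> 1 %[mod 4])%N -> gauss_sum B ^+ 2 = - D%:R).
Proof.
move=> D_odd TT; have [s Is Ts] := gauss_sum_mod2.
have T44 := gauss_sum_exp4 B_bi.
set T := gauss_sum B in TT T44 Ts *.
have T2 : T ^+ 2 = 1 + 4 * (s + s ^+ 2) by rewrite Ts; ring.
have Is2 : integralOver intr (s + s ^+ 2) by apply: integral_add => //;
  apply: integral_mul.
have T8 : (T ^+ 4 - D%:R ^+ 2) * (T ^+ 4 + D%:R ^+ 2) = 0.
  rewrite -subr_sqr; apply/eqP; rewrite subr_eq0; apply/eqP.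
  by rewrite expr2 {2}T44 -exprMn TT -exprM.
have T4 : T ^+ 4 = D%:R ^+ 2.
  move/eqP: T8; rewrite mulf_eq0 => /orP[]; first by rewrite subr_eq0 => /eqP.
  rewrite addr_eq0 => /eqP T4; exfalso.
  pose z := 2 * (s + s ^+ 2) + 4 * (s + s ^+ 2) ^+ 2.
  have Iz : integralOver (intr : int -> F) z.
    have I2 := Is2; apply: integral_add; apply: integral_mul => //.
    - exact: (integral_nat _ 2).
    - exact: (integral_nat _ 4).
    - exact: integral_mul.
  have : 4 * z = (- (D%:Z ^+ 2) - 1)%:~R.
    rewrite rmorphB rmorphN rmorphXn /= -[(D : int)%:~R]/(D%:R : F) -T4.
    have -> : T ^+ 4 = (T ^+ 2) ^+ 2 by rewrite -exprM.
    by rewrite T2 /z; ring.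
  move/(integral_quarter Iz) => /dvdzP[q Dq].
  have := odd_double_half D; rewrite D_odd => De; move: Dq; rewrite -De.
  by move: (D./2) => h; rewrite -muln2; nia.
have /orP[/eqP TD|/eqP TD] : (T ^+ 2 == D%:R) || (T ^+ 2 == - D%:R).
  by rewrite -eqf_sqr -exprM T4.
  have : 4 * (s + s ^+ 2) = (D%:Z - 1)%:~R.
    by rewrite rmorphB /= -[(D : int)%:~R]/(D%:R : F) -TD T2; ring.
  move/(integral_quarter Is2) => /dvdzP[q Dq].
  by split=> //; case; lia.
have : 4 * (s + s ^+ 2) = (- D%:Z - 1)%:~R.
  by rewrite rmorphB rmorphN /= -[(D : int)%:~R]/(D%:R : F) -TD T2; ring.
move/(integral_quarter Is2) => /dvdzP[q Dq].
by split=> // D1; exfalso; lia.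
Qed.
End Odd.

(** * The chain form on A^n and its radical *)

Section Pad.
Variable A : zmodType.

(** pad x is the sequence 0, x_1, ..., x_n, 0, 0, ...: the coordinates of x are
    shifted by one and extended by 0 on both sides. *)
Definition pad n (x : {ffun 'I_n -> A}) (i : nat) : A :=
  if i is j.+1 then oapp x 0 (insub j) else 0.

Lemma pad0 n (x : {ffun 'I_n -> A}) : pad x 0 = 0. Proof. by []. Qed.

Lemma pad_ord n (x : {ffun 'I_n -> A}) (i : 'I_n) : pad x i.+1 = x i.
Proof. by rewrite /pad valK. Qed.

Lemma pad_out n (x : {ffun 'I_n -> A}) : pad x n.+1 = 0.
Proof. by rewrite /pad insubF // ltnn. Qed.

Lemma padD n (x y : {ffun 'I_n -> A}) i : pad (x + y) i = pad x i + pad y i.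
Proof.
rewrite /pad; case: i => [|i]; first by rewrite addr0.
by case: insub => [j|] /=; rewrite ?ffunE ?addr0.
Qed.

Definition cons_ffun n (a : A) (x : {ffun 'I_n -> A}) : {ffun 'I_n.+1 -> A} :=
  [ffun i => oapp x a (unlift ord0 i)].

Lemma pad_cons1 n a (x : {ffun 'I_n -> A}) : pad (cons_ffun a x) 1 = a.
Proof. by rewrite (pad_ord _ ord0) ffunE unlift_none. Qed.

Lemma pad_consS n a (x : {ffun 'I_n -> A}) i :
  pad (cons_ffun a x) i.+2 = pad x i.+1.
Proof.
have [lt_in|le_ni] := ltnP i n;
  last by rewrite /pad !insubF // ltnNge ?ltnS le_ni.
rewrite (pad_ord x (Ordinal lt_in)) -[i.+1]/(lift ord0 (Ordinal lt_in) : nat).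
by rewrite pad_ord ffunE liftK.
Qed.
End Pad.
Arguments pad : simpl never.

Section Chain.
Variables (F : numClosedFieldType) (A : finZmodType) (chi : A -> A -> F).
Hypothesis chi_bi : biadditive chi.
Hypothesis chi_sym : forall a b, chi a b = chi b a.
Hypothesis chi_nd : forall a, (forall x, chi x a = 1) -> a = 0.

(** The form prod_i chi(x_i, z_(i-1) - z_i), with z_0 = 0. *)
Definition chain n (x z : {ffun 'I_n -> A}) : F :=
  \prod_(i < n) chi (x i) (pad z i - pad z i.+1).

Lemma chain_bi n : biadditive (@chain n).
Proof.
split=> [x z|x y z|x y z]; first by apply/prodf_neq0 => i _; apply: bi_neq0.
  by rewrite -big_split; apply: eq_bigr => i _; rewrite ffunE /= bi_addl.
rewrite -big_split; apply: eq_bigr => i _ /=.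
by rewrite -bi_addr // !padD opprD addrACA.
Qed.

Lemma chain_cons n a (x : {ffun 'I_n -> A}) :
  chain (cons_ffun a x) (cons_ffun a x) = (chi a a)^-1 * chi (pad x 1) a
    * chain x x.
Proof.
rewrite /chain big_ord_recl -!pad_ord pad_cons1 /= sub0r bi_oppr // -mulrA;
  congr (_ * _).
under eq_bigr => i _ do rewrite -pad_ord lift0 pad_consS.
case: n x => [|n] x; first by rewrite !big_ord0 pad_out bi_0l // mulr1.
rewrite big_ord_recl [in RHS]big_ord_recl /= -!pad_ord pad_cons1 sub0r mulrA;
  congr (_ * _).
  by rewrite bi_oppr // bi_addr // bi_oppr.
by apply: eq_bigr => i _; rewrite /bump /= add1n pad_consS -pad_ord lift0.
Qed.

Lemma sum_cons_ffun n (f : {ffun 'I_n.+1 -> A} -> F) :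
  \sum_x f x = \sum_a \sum_x f (cons_ffun a x).
Proof.
rewrite pair_bigA (reindex (fun p => cons_ffun p.1 p.2)) //=.
exists (fun c : {ffun 'I_n.+1 -> A} => (c ord0, [ffun j => c (lift ord0 j)])) =>
  [[a x]|c] _ /=.
  rewrite ffunE unlift_none; congr (_, _); apply/ffunP => j.
  by rewrite !ffunE liftK.
by apply/ffunP => i; rewrite ffunE; case: unliftP => [j ->|->] //=;
  rewrite ffunE.
Qed.

(** The second difference of x, with value 0 at both ends. *)
Definition lap n (x : {ffun 'I_n -> A}) (i : nat) : A :=
  pad x i.+2 - pad x i.+1 + (pad x i - pad x i.+1).

(** Summation by parts; there is no boundary term since pad x and pad z vanish
    at the ends. *)
Lemma chain_by_parts n (x z : {ffun 'I_n -> A}) :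
  chain x z = \prod_(i < n) chi (pad x i.+2 - pad x i.+1) (z i).
Proof.
transitivity ((\prod_(i < n) chi (pad x i.+1) (pad z i))
  * \prod_(i < n) (chi (pad x i.+1) (pad z i.+1))^-1).
  by rewrite -big_split; apply: eq_bigr => i _;
    rewrite -pad_ord bi_addr // bi_oppr.
have -> : \prod_(i < n) chi (pad x i.+1) (pad z i)
  = \prod_(i < n) chi (pad x i.+2) (pad z i.+1).
  transitivity (\prod_(i < n.+1) chi (pad x i.+1) (pad z i)).
    by rewrite big_ord_recr /= pad_out bi_0l // mulr1.
  by rewrite big_ord_recl [chi _ _]bi_0r // mul1r.
by rewrite -big_split; apply: eq_bigr => i _;
  rewrite -pad_ord /= bi_addl // bi_oppl.
Qed.

Lemma chain_polar n (x z : {ffun 'I_n -> A}) :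
  chain x z * chain z x = \prod_(i < n) chi (lap x i) (z i).
Proof.
rewrite chain_by_parts -big_split; apply: eq_bigr => i _.
by rewrite /= [chi (z i) _]chi_sym -bi_addl.
Qed.

Lemma sum_nondegenerate d : \sum_c chi d c = (d == 0)%:R * #|A|%:R.
Proof.
have [->|d0] := eqVneq d 0.
  by under eq_bigr do rewrite bi_0l //; rewrite sumr_const mul1r.
rewrite mul0r; have [c dc] : exists c, chi d c != 1.
  apply/existsP; apply: contraNT d0 => /existsPn dc; apply/eqP/chi_nd => x.
  by rewrite chi_sym; apply/eqP; rewrite -[_ == _]negbK dc.
apply/eqP; have : (chi d c - 1) * \sum_c chi d c == 0.
  rewrite mulrBl mul1r subr_eq0 [X in _ == X](reindex_inj (addrI c)) mulr_sumr.
  by apply/eqP/eq_bigr => b _; rewrite bi_addr.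
by rewrite mulf_eq0 subr_eq0 (negbTE dc).
Qed.

(** The subgroup A[k]. *)
Definition torsion k : {set A} := [set a | a *+ k == 0].

(** A sequence with zero second difference that starts at 0 is an arithmetic
    progression. *)
Lemma lap_eq0 n (x : {ffun 'I_n -> A}) : (forall i : 'I_n, lap x i = 0) ->
  forall i, (i <= n.+1)%N -> pad x i = pad x 1 *+ i.
Proof.
move=> xn; suff H i : (i <= n)%N -> pad x i = pad x 1 *+ i /\ pad x i.+1
  = pad x 1 *+ i.+1.
  by case=> [|i] // /H[].
elim: i => [|i IH] // lt_in; have [xi xi1] := IH (ltnW lt_in); split=> //.
have -> : pad x i.+2 = lap x i + pad x i.+1 + (pad x i.+1 - pad x i).
  by rewrite /lap -(addrA (_ - _)) subrK -addrA [pad x i + _]addrC !subrK.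
by rewrite (xn (Ordinal lt_in)) add0r xi xi1 [in X in _ + X]mulrS addrK -mulrSr.
Qed.

(** The sequence a, 2a, ..., na; it solves the boundary value problem when
    (n + 1) a = 0. *)
Definition progression n (a : A) : {ffun 'I_n -> A} :=
  [ffun i : 'I_n => a *+ i.+1].

Lemma pad_progression n a i : a \in torsion n.+1 -> (i <= n.+1)%N ->
  pad (progression n a) i = a *+ i.
Proof.
rewrite inE => /eqP an; case: i => [|i]; first by rewrite pad0.
rewrite ltnS leq_eqVlt => /predU1P[->|lt_in]; first by rewrite pad_out.
by rewrite (pad_ord _ (Ordinal lt_in)) ffunE.
Qed.

Lemma lap_progression n a (i : 'I_n) : a \in torsion n.+1 ->
  lap (progression n a) i = 0.
Proof.
move=> an; have lt_in := ltn_ord i.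
rewrite /lap !pad_progression ?ltnS // 1?ltnW // 1?ltnW //.
by rewrite mulrS addrK [a *+ i.+1]mulrS opprD addrCA addNKr subrr.
Qed.

Lemma chain_progression n a : a \in torsion n.+1 ->
  chain (progression n a) (progression n a) = (chi a a ^+ 'C(n.+1, 2))^-1.
Proof.
move=> an; transitivity (\prod_(i < n) (chi a a)^-1 ^+ i.+1).
  apply: eq_bigr => i _; have lt_in := ltn_ord i.
  rewrite !pad_progression // 1?ltnW //; last by rewrite ltnW.
  by rewrite mulrS opprD addrCA subrr addr0 ffunE bi_mulnl // bi_oppr.
by rewrite prodrXr exprVn -bin2_sum big_nat_recl // add0n big_mkord.
Qed.

Lemma gauss_sum_chain_norm n :
  gauss_sum (@chain n) * (gauss_sum (@chain n))^* =
  #|A|%:R ^+ n * \sum_(a in torsion n.+1) (chi a a ^+ 'C(n.+1, 2))^-1.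
Proof.
rewrite (gauss_sum_norm (chain_bi n)).
transitivity (\sum_(x : {ffun 'I_n -> A} | [forall i : 'I_n, lap x i == 0])
                 #|A|%:R ^+ n * chain x x).
  rewrite [RHS]big_mkcond; apply: eq_bigr => x _.
  have -> : \sum_z chain x z * chain z x = \prod_(i < n) \sum_c chi (lap x i) c.
    rewrite (bigA_distr_bigA (fun (i : 'I_n) c => chi (lap x i) c)).
    by apply: eq_bigr => z _; rewrite chain_polar.
  under eq_bigr => i _ do rewrite sum_nondegenerate.
  case: ifPn => [/forallP x0|/forallPn[i /negbTE xi]].
    under eq_bigr => i _ do rewrite x0 mul1r.
    by rewrite prodr_const card_ord mulrC.
  by rewrite (bigD1 i) //= xi !mul0r mulr0.
rewrite -mulr_sumr; congr (_ * _).
rewrite (reindex_onto (progression n) (fun x => pad x 1)) /=; last first.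
  move=> x /forallP x0; apply/ffunP => i; rewrite ffunE -lap_eq0 ?pad_ord // =>
    [j|].
    exact/eqP/x0.
  by rewrite ltnS ltnW.
apply: eq_big => [a|a].
  apply/andP/idP => [[/forallP x0 /eqP pa]|an].
    rewrite inE -pa -lap_eq0 ?pad_out // => j; exact/eqP/x0.
  split; first by apply/forallP => i; rewrite lap_progression.
  by rewrite pad_progression.
case/andP => /forallP x0 /eqP pa; apply: chain_progression.
rewrite inE -pa -lap_eq0 ?pad_out // => j; exact/eqP/x0.
Qed.

(** The cross term is chi(a, b) ^ (k (k - 1)), which is 1 on A[k]. *)
Lemma torsion_char k (psi := fun a => chi a a ^+ 'C(k, 2)) :
  {in torsion k &, {morph psi : a b / a + b >-> a * b}}.
Proof.
move=> a b; rewrite !inE => /eqP ak _; rewrite /psi bi_addl // !bi_addr //.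
rewrite [chi b a]chi_sym.
have -> : chi a a * chi a b * (chi a b * chi b b) = chi a a * chi b b
  * chi a b ^+ 2 by ring.
rewrite 2!exprMn -(exprM (chi a b) 2) -mul_bin_diag exprM
  -(bi_mulnl chi_bi a b k) ak bi_0l //.
by rewrite expr1n mulr1.
Qed.

Lemma sum_torsion_char k (psi := fun a => (chi a a ^+ 'C(k, 2))^-1) :
  \sum_(a in torsion k) psi a =
  if [forall a in torsion k, chi a a ^+ 'C(k, 2) == 1]
  then #|torsion k|%:R else 0.
Proof.
case: ifPn => [/forall_inP p1|].
  under eq_bigr => a ak do rewrite /psi (eqP (p1 a ak)) invr1.
  by rewrite sumr_const.
case/forall_inPn => b bk b1.
have : (psi b - 1) * \sum_(a in torsion k) psi a == 0.
  rewrite mulrBl mul1r subr_eq0 [X in _ == X](reindex_inj (addrI b)) mulr_sumr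
    /=.
  apply/eqP/eq_big => [a|a ak].
    by rewrite !inE mulrnDl (eqP (_ : b *+ k == 0)) ?add0r //;
      rewrite inE in bk.
  by rewrite /psi torsion_char // invfM.
by rewrite mulf_eq0 subr_eq0 invr_eq1 (negbTE b1) => /eqP.
Qed.

End Chain.

(** * The indicators of m *)

(** The abelian group A written additively. *)
Definition additive (A : finGroupType) (cA : abelian [set: A]) : Type := A.

Section Additive.
Variables (A : finGroupType) (cA : abelian [set: A]).

HB.instance Definition _ := Finite.on (additive cA).

Lemma additive_addC : commutative
  (fun a b : additive cA => (a * b)%g : additive cA).
Proof. by move=> a b; apply: (centsP cA); rewrite inE. Qed.

HB.instance Definition _ := GRing.isZmodule.Build (additive cA)
  (@mulgA A) additive_addC (@mul1g A) (@mulVg A).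

Lemma additive_muln (a : additive cA) n : a *+ n = (a ^+ n)%g :> A.
Proof. by elim: n => // n IH; rewrite mulrS expgS -IH. Qed.

Lemma mem_torsion_additive k (a : A) :
  (a \in torsion (additive cA) k) = (a \in 'Ldiv_k([set: A])%g).
Proof. by rewrite !inE additive_muln. Qed.

Lemma card_torsion_additive k : #|torsion (additive cA) k|
  = #|'Ldiv_k([set: A])%g|.
Proof. by apply: eq_card => a; exact: mem_torsion_additive. Qed.

End Additive.

Lemma indicator_sum_chain (R : realType) (A : finGroupType)
    (cA : abelian [set: A])
    (chi : additive cA -> additive cA -> R[i]) (tau : R) n (y : additive cA) :
  biadditive chi ->
  indicator_sum (chi : A -> A -> R[i]) tau n y = tau%:C%C ^+ n *
    \sum_(x : {ffun 'I_n -> additive cA}) chi (pad x 1) y * chain chi x x.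
Proof.
move=> chi_bi; elim: n y => [|n IH] y.
  have x0 (x : {ffun 'I_0 -> additive cA}) : x = 0 by apply/ffunP => -[].
  rewrite expr0 mul1r (big_only1 0) // => [|x]; last by rewrite (x0 x) eqxx.
  by rewrite pad_out (bi_0l chi_bi) /chain big_ord0 mulr1.
transitivity (\sum_(a : additive cA) chi a y * (tau%:C%C * (chi a a)^-1)
  * indicator_sum (chi : A -> A -> R[i]) tau n a) => //.
rewrite (sum_cons_ffun (fun x => chi (pad x 1) y * chain chi x x)) mulr_sumr.
apply: eq_bigr => a _; rewrite IH !mulr_sumr; apply: eq_bigr => x _.
by rewrite chain_cons // pad_cons1 exprS; ring.
Qed.

(** For a in A[k] and n = k the factor rho(a^n) is 1. *)
Lemma quad_funs_expn (A : finGroupType) (F : fieldType)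
    (chi : A -> A -> F) rho :
  bicharacter chi -> quad_funs chi rho -> forall a n,
  rho a ^+ n = rho (a ^+ n)%g * chi a a ^+ 'C(n, 2).
Proof.
case=> chi0 chiMl chiMr [rho0 rhoE] a.
have chi1 b : chi b 1%g = 1.
  by apply: (mulfI (chi0 b 1%g)); rewrite -chiMr mulg1 mulr1.
have chiX n : chi a (a ^+ n)%g = chi a a ^+ n.
  by elim: n => [|n IH]; rewrite ?chi1 // expgS chiMr IH exprS.
elim=> [|n IH].
  by rewrite bin0n mulr1; have := rhoE 1%g 1%g;
    rewrite mulg1 chi1 divff // mul1r => ->.
rewrite exprS IH binS bin1 exprD -(chiX n) -(rhoE a (a ^+ n)%g) -expgS.
by have := rho0 (a ^+ n.+1)%g => ?; field.
Qed.

Section Assembly.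
Variables (R : realType) (A : finZmodType) (chi : A -> A -> R[i]).
Variables (tau : R) (n : nat).
Hypothesis chi_bi : biadditive chi.
Hypothesis chi_sym : forall a b, chi a b = chi b a.
Hypothesis chi_nd : forall a, (forall x, chi x a = 1) -> a = 0.
Hypothesis tau2 : tau ^+ 2 = #|A|%:R^-1.

(* xi is the indicator nu divided by the square root of |A[n + 1]|; trivial says
   that the character chi(a, a) ^ C(n + 1, 2) of A[n + 1] is trivial. *)
Let T := gauss_sum (@chain _ _ chi n).
Let D := #|torsion A n.+1|.
Let nu := (Num.sg tau)%:C%C * (tau%:C%C ^+ n * T).
Let xi := nu / sqrtC D%:R.
Let trivial := [forall a in torsion A n.+1, chi a a ^+ 'C(n.+1, 2) == 1].

Lemma card_torsion_gt0 : (0 < D)%N.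
Proof. by apply/card_gt0P; exists 0; rewrite inE mul0rn. Qed.

Lemma sqrt_card_neq0 : sqrtC (D%:R : R[i]) != 0.
Proof. by rewrite sqrtC_eq0 pnatr_eq0 -lt0n card_torsion_gt0. Qed.

Lemma tau_neq0 : tau != 0.
Proof.
apply: contraTneq (ltr0Sn R 0) => t0; move/eqP: tau2.
by rewrite t0 expr0n /= eq_sym invr_eq0 pnatr_eq0 => /eqP A0; have :=
  card_zmod_gt0 A; rewrite A0.
Qed.

Lemma sg_tau_sqr : (Num.sg tau)%:C%C ^+ 2 = 1 :> R[i].
Proof. by rewrite -rmorphXn /= sqr_sg tau_neq0. Qed.

Lemma tau_sqr : tau%:C%C ^+ 2 = #|A|%:R^-1 :> R[i].
Proof. by rewrite -rmorphXn /= tau2 fmorphV rmorph_nat. Qed.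

Lemma gauss_norm : T * T^* = if trivial then (#|A| ^ n * D)%:R else 0.
Proof.
rewrite /T gauss_sum_chain_norm // sum_torsion_char // -/trivial.
by case: ifP => _; rewrite ?mulr0 // natrM natrX.
Qed.

Lemma indicator_xi : nu = sqrtC D%:R * xi.
Proof. by rewrite /xi mulrC divfK // sqrt_card_neq0. Qed.

Lemma xi_eq0 : (xi == 0) = ~~ trivial.
Proof.
rewrite /xi mulf_eq0 invr_eq0 (negbTE sqrt_card_neq0) orbF /nu mulf_eq0.
rewrite mulf_eq0 expf_eq0 !fmorph_eq0 sgr_eq0 (negbTE tau_neq0) andbF /=.
have := gauss_norm; case: trivial => [TT|/eqP]; last by rewrite mul_conjC_eq0.
apply/negbTE; rewrite -mul_conjC_eq0 TT pnatr_eq0 -lt0n.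
by rewrite muln_gt0 expn_gt0 card_zmod_gt0 card_torsion_gt0.
Qed.

Lemma xi_sqr : xi ^+ 2 = T ^+ 2 / (#|A| ^ n * D)%:R.
Proof.
rewrite /xi /nu !exprMn exprVn sqrtCK sg_tau_sqr mul1r -exprM mulnC exprM
  tau_sqr.
by rewrite natrM natrX invfM exprVn; ring.
Qed.

Lemma xi_unity : trivial -> xi ^+ 8 = 1.
Proof.
move=> tr; have := gauss_norm; rewrite tr => TT.
have e8 : T ^+ 8 = (#|A| ^ n * D)%:R ^+ 4.
  rewrite -TT exprMn /T -gauss_sum_exp4 -?exprD //; exact: chain_bi.
rewrite (exprM xi 2 4) xi_sqr exprMn -exprM e8 exprVn divff // expf_eq0 /=.
by rewrite pnatr_eq0 -lt0n muln_gt0 expn_gt0 card_zmod_gt0 card_torsion_gt0.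
Qed.

Lemma odd_trivial : odd #|A| -> trivial.
Proof.
move=> oA; apply/forall_inP => a; rewrite inE => /eqP an.
(* u has odd order, and u ^ 2 = chi(a, a) ^ (n (n + 1)) = 1 *)
set u := chi a a ^+ _.
have u2 : u ^+ 2 = 1.
  by rewrite /u -exprM mulnC -mul_bin_diag exprM -bi_mulnl // an bi_0l //
    expr1n.
have uN : u ^+ #|A| = 1 by rewrite /u exprAC bi_card // expr1n.
by move: uN; rewrite -(odd_double_half #|A|) oA exprD -mul2n exprM u2 expr1n
  mulr1 => /eqP.
Qed.

Lemma xi_odd : odd #|A| -> (D %| #|A| ^ n)%N ->
  (((#|A| ^ n) %/ D = 1 %[mod 4])%N -> xi ^+ 2 = 1) /\
  (((#|A| ^ n) %/ D <> 1 %[mod 4])%N -> xi ^+ 2 = -1).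
Proof.
move=> oA /dvdnP[q An]; rewrite An mulnK ?card_torsion_gt0 //.
have oAn : odd (#|A| ^ n) by rewrite oddX oA orbT.
have := oAn; rewrite An oddM => /andP[oq oD].
have oE : odd (#|A| ^ n * D) by rewrite oddM oAn.
have E0 : (#|A| ^ n * D)%:R != 0 :> R[i] by rewrite pnatr_eq0;
  case: (_ * _)%N oE.
have oV : odd #|{ffun 'I_n -> A}| by rewrite card_ffun card_ord.
have := gauss_norm; rewrite odd_trivial // => TT.
have [T1 T3] := gauss_sum_odd_sqr (chain_bi chi_bi n) oV oE TT.
(* the square of the odd number D is 1 modulo 4 *)
have E4 : (#|A| ^ n * D = q %[mod 4])%N.
  rewrite An -mulnA -[D]odd_double_half oD; move: D./2 => h.
  have -> : (q * ((true + h.*2) * (true + h.*2)) = q + 4 * (q * (h * h + h)))%N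
    by lia.
  by rewrite addnC [(4 * _)%N]mulnC modnMDl.
split=> q4; rewrite xi_sqr.
  by rewrite -/T T1 ?divff // E4.
by rewrite -/T T3 ?E4 // mulNr divff.
Qed.

End Assembly.

Theorem theorem3p5 (R : realType) (A : finGroupType)
    (chi : A -> A -> R[i]) (tau : R) (k : nat) :
  abelian [set: A] ->
  bicharacter chi -> symmetric_bichar chi -> nondegenerate_bichar chi ->
  tau ^+ 2 = #|A|%:R^-1 ->
  (0 < k)%N ->
  exists xi : R[i],
    [/\ 8.-unity_root xi \/ xi = 0,
        FSind (2 * k) (TYm chi tau) = sqrtC #|'Ldiv_k([set: A])%g|%:R * xi,
        forall rho : A -> R[i], quad_funs chi rho ->
          (xi = 0 <-> exists2 a : A, a \in 'Ldiv_k([set: A])%g & rho a ^+ k != 1)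
      & odd #|A| ->
          (((#|A| ^ k.-1) %/ #|'Ldiv_k([set: A])%g| = 1 %[mod 4])%N ->
             xi ^+ 2 = 1)
          /\ (((#|A| ^ k.-1) %/ #|'Ldiv_k([set: A])%g| <> 1 %[mod 4])%N ->
             xi ^+ 2 = -1)].
Proof.
move=> cA chi_bich chi_sym chi_nd tau2; case: k => // n _.
have chi_bi : biadditive (chi : additive cA -> additive cA -> R[i]).
  by case: chi_bich.
have tau0 : tau != 0 := tau_neq0 (A := additive cA) tau2.
have chi11 : chi 1%g 1%g = 1 := bi_0l chi_bi _.
pose c : additive cA -> additive cA -> R[i] := chi.
pose nu : R[i] := (Num.sg tau)%:C%C
  * (tau%:C%C ^+ n * gauss_sum (@chain _ _ c n)).
have nuE : FSind (2 * n.+1) (TYm chi tau) = nu.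
  rewrite mul2n doubleS FSind_indicator_sum // -[chi]/(c : A -> A -> R[i])
    (indicator_sum_chain tau n 1%g chi_bi).
  congr (_ * (_ * _)); apply: eq_bigr => x _.
  by rewrite (_ : chi (pad x 1) 1%g = 1) ?mul1r //; exact: (bi_0r chi_bi).
(* for n = 0 this reads |A[1]| = 1; otherwise A[n + 1] is a subgroup of A *)
have D_dvd : (#|'Ldiv_n.+1([set: A])%g| %| #|A| ^ n)%N.
  case: n {nu nuE} => [|n].
    rewrite expn0 dvdn1; apply/eqP;
      rewrite (_ : 'Ldiv_1(_)%g = [set 1%g]) ?cards1 //.
    by apply/setP => a; rewrite !inE expg1.
  rewrite expnS dvdn_mulr // -cardsT.
  have -> : 'Ldiv_n.+2([set: A])%g = Group (group_Ldiv n.+2 cA) by [].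
  by rewrite cardSg // subsetT.
exists (nu / sqrtC #|torsion (additive cA) n.+1|%:R);
  rewrite -!(card_torsion_additive cA).
split.
- case: (boolP [forall a in torsion (additive cA) n.+1,
  c a a ^+ 'C(n.+1, 2) == 1]) => tr.
    by left; apply/unity_rootP; apply: xi_unity.
  by right; apply/eqP; rewrite xi_eq0.
- by rewrite nuE [LHS]indicator_xi.
- move=> rho rhoP.
  have rhoE a : a \in 'Ldiv_n.+1([set: A])%g ->
      rho a ^+ n.+1 = chi a a ^+ 'C(n.+1, 2).
    rewrite !inE => /eqP an; rewrite (quad_funs_expn chi_bich rhoP) an.
    have := quad_funs_expn chi_bich rhoP 1%g 0.
    by rewrite expg0 !expr0 mulr1 => <-; rewrite mul1r.
  split=> [/eqP|[a an ra]].
    rewrite xi_eq0 // => /forall_inPn[a an ca]; exists a;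
      first by rewrite -mem_torsion_additive.
    by rewrite rhoE // -mem_torsion_additive.
  have anT : (a : additive cA) \in torsion (additive cA) n.+1.
    by rewrite mem_torsion_additive.
  apply/eqP; rewrite xi_eq0 //; apply/forall_inPn.
  exists (a : additive cA) => //.
  by rewrite /= -rhoE.
- by move=> oA; apply: xi_odd => //; rewrite card_torsion_additive.
Qed.
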